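(* Let $n,m\ge1$. Let $J=(J_i)_{i=1}^m$ be a sequence of measurable, nonnegative and even kernels. Let $\sigma=(\sigma_i)_{i=1}^m$ and $\phi=(\phi_i)_{i=1}^m$ be functions on $\mathbb R^n$ such that each $\phi_i$ does not change sign and, for every $\eta\in C_c^1(\mathbb R^n)$, $$\sum_{i=1}^m\int_{\mathbb R^n}\int_{\mathbb R^n}\sigma_i(x)[\sigma_i(x)-\sigma_i(z)]\,\phi_i(z)\phi_i(x)\,J_i(x-z)\,\eta^2(x)\,dz\,dx\le0.$$ Assume also that, with a constant $C$ independent of $R$, for all large $R$, $$\sum_{i=1}^m\iint_{\bigcup_{k=1}^4\Gamma_R^k}[\sigma_i(x)+\sigma_i(z)]^2\phi_i(x)\phi_i(z)\,|x-z|^2J_i(x-z)\,dz\,dx\le CR^2.$$ Then each $\sigma_i$ must be constant.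
   Context: With $B_R$ the ball of radius $R$ centred at the origin of $\mathbb R^n$, $$\Gamma_R^1=B_R\times(B_{2R}\setminus B_R),\quad \Gamma_R^2=(B_{2R}\setminus B_R)\times(B_{2R}\setminus B_R),$$ $$\Gamma_R^3=(B_{2R}\setminus B_R)\times(\mathbb R^n\setminus B_{2R}),\quad \Gamma_R^4=B_R\times(\mathbb R^n\setminus B_{2R}).$$ ''$\phi_i$ does not change sign'' means $\phi_i(x)\phi_i(z)>0$ for all $x,z$. The functions $\sigma_i,\phi_i$ are measurable (constancy being understood up to null sets if they are not continuous), and singular inner integrals are understood in the principal value sense $\lim_{\epsilon\to0}\int_{\mathbb R^n\setminus B_\epsilon(x)}$.
   Formalization: Added: no kernel J_i is a.e. zero; for every η each principal value integral is well defined (integrable off the diagonal, inner value exists a.e. and is integrable in x), and the outer integrals of the ε-truncated inner integrals converge to it. Without these the claim fails. *)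

(* Defs.v *)
From HB Require Import structures.
From mathcomp Require Import all_boot all_order all_algebra.
From mathcomp Require Import all_classical all_reals all_analysis.

Set Implicit Arguments.
Unset Strict Implicit.
Unset Printing Implicit Defensive.
Import Order.TTheory GRing.Theory Num.Theory.
Import numFieldNormedType.Exports.

Local Open Scope classical_set_scope.
Local Open Scope ring_scope.

(* The product sigma-algebra on row vectors, generated by the coordinates;
   for 'rV[R]_n it is the Borel sigma-algebra of R^n. *)
Section measurable_rV.
Context {d : measure_display} {T : measurableType d}.
Variable n : nat.

Let coord (i : 'I_n) (v : 'rV[T]_n) : T := v ord0 i.

Let rV_set0 : g_sigma_preimage coord set0.
Proof. exact: sigma_algebra0. Qed.

Let rV_setC A : g_sigma_preimage coord A -> g_sigma_preimage coord (~` A).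
Proof. exact: sigma_algebraC. Qed.

Let rV_bigcup (F : _^nat) : (forall i, g_sigma_preimage coord (F i)) ->
  g_sigma_preimage coord (\bigcup_i (F i)).
Proof. exact: sigma_algebra_bigcup. Qed.

HB.instance Definition _ := @isMeasurable.Build (measure_tuple_display d)
  'rV[T]_n (g_sigma_preimage coord) rV_set0 rV_setC rV_bigcup.

End measurable_rV.

Lemma measurable_coord d (T : measurableType d) n (i : 'I_n) :
  measurable_fun [set: 'rV[T]_n] (fun v : 'rV[T]_n => v ord0 i).
Proof.
move=> _ Y mY; rewrite setTI; apply: sub_sigma_algebra => /=.
rewrite -bigcup_seq/=; exists i => /=; first by rewrite mem_index_enum.
by exists Y => //; rewrite setTI.
Qed.

Lemma measurable_fun_coordP d1 d2 (T1 : measurableType d1)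
    (T2 : measurableType d2) n (f : T1 -> 'rV[T2]_n) :
  (forall i, measurable_fun [set: T1] (fun x => f x ord0 i)) ->
  measurable_fun [set: T1] f.
Proof.
move=> mf.
suff S : g_sigma_preimage (fun i x => f x ord0 i) `<=` measurable.
  move=> _ A mA; rewrite setTI; apply: S.
  rewrite (_ : (fun i x => _) =
    (fun i => (fun v : 'rV[T2]_n => v ord0 i) \o f))//.
  by rewrite g_sigma_preimage_comp; exists A; rewrite ?setTI.
apply: smallest_sub; first exact: sigma_algebra_measurable.
case: n => [|n] in f mf *; first by rewrite big_ord0.
rewrite -bigcup_mkord_ord; apply: bigcup_sub => i Ii.
by move=> A [B mB <-]; exact: mf.
Qed.

Section lebesgue_rV.
Context {R : realType}.

Definition rV_cons n (p : measurableTypeR R * 'rV[R]_n) : 'rV[R]_n.+1 :=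
  \row_i (if unlift ord0 i is Some j then p.2 ord0 j else p.1).

Definition rV_uncons n (v : 'rV[R]_n.+1) : measurableTypeR R * 'rV[R]_n :=
  (v ord0 ord0, \row_i v ord0 (lift ord0 i)).

Lemma rV_consK n : cancel (@rV_cons n) (@rV_uncons n).
Proof.
move=> [x v]; rewrite /rV_uncons /rV_cons mxE unlift_none/=; congr pair.
by apply/rowP => i; rewrite !mxE liftK.
Qed.

Lemma measurable_rV_cons n : measurable_fun setT (@rV_cons n).
Proof.
apply: measurable_fun_coordP => i; rewrite /rV_cons.
under eq_fun do rewrite mxE.
case: unliftP => [j _|_]; last exact: measurable_fst.
exact: (measurableT_comp (measurable_coord j) measurable_snd).
Qed.

Lemma measurable_rV_uncons n : measurable_fun setT (@rV_uncons n).
Proof.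
apply/measurable_fun_pairP; split; first exact: measurable_coord.
apply: measurable_fun_coordP => i.
rewrite (_ : (fun _ => _) = fun v : 'rV[R]_n.+1 => v ord0 (lift ord0 i)).
  exact: measurable_coord.
by apply/funext => v /=; rewrite mxE.
Qed.


Section lebesgue_cons.
Variables (n : nat) (mu : {sigma_finite_measure set 'rV[R]_n -> \bar R}).

Definition lebesgue_cons : set 'rV[R]_n.+1 -> \bar R :=
  pushforward (@lebesgue_measure R \x mu)%E (@rV_cons n).

HB.instance Definition _ := Measure.copy lebesgue_cons
  (measure_function_pushforward__canonical__measure_function_Measure
    (@lebesgue_measure R \x mu)%E (@measurable_rV_cons n)).

Let lebesgue_cons_sigma_finite : sigma_finite setT lebesgue_cons.
Proof.
have /sigma_finiteP[F [FT ndF mF]] := sigma_finiteT (@lebesgue_measure R).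
have /sigma_finiteP[G [GT ndG mG]] := sigma_finiteT mu.
exists (fun k => @rV_uncons n @^-1` (F k `*` G k)).
  rewrite -preimage_bigcup (_ : \bigcup_k _ = setT) ?preimage_setT//.
  rewrite -subTset => -[x v] _.
  have [k _ Fkx] : (\bigcup_k F k) x by rewrite -FT.
  have [l _ Glv] : (\bigcup_k G k) v by rewrite -GT.
  exists (maxn k l) => //; split => /=.
  - by move: x Fkx; exact/subsetPset/ndF/leq_maxl.
  - by move: v Glv; exact/subsetPset/ndG/leq_maxr.
move=> k; have [mFk Fkoo] := mF k; have [mGk Gkoo] := mG k; split.
  rewrite -[X in measurable X]setTI; apply: measurable_rV_uncons => //.
  exact: measurableX.
rewrite /lebesgue_cons /pushforward -comp_preimage.
rewrite (_ : _ \o _ = id) ?preimage_id; last exact/funext/rV_consK.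
by rewrite product_measure1E// lte_mul_pinfty// ge0_fin_numE.
Qed.

HB.instance Definition _ := Measure_isSigmaFinite.Build _ _ _ lebesgue_cons
  lebesgue_cons_sigma_finite.

End lebesgue_cons.

(* Lebesgue measure on R^n (on Borel sets), as the n-fold product of the one
   on R. *)
Fixpoint lebesgue_rV n : {sigma_finite_measure set 'rV[R]_n -> \bar R} :=
  match n with
  | 0 => \d_(0 : 'rV[R]_0)
  | n'.+1 => lebesgue_cons (lebesgue_rV n')
  end.

Lemma lebesgue_rV_box n (A : 'I_n -> set R) :
  (forall i, measurable (A i)) ->
  (lebesgue_rV n [set v | forall i, A i (v ord0 i)]
   = \prod_(i < n) lebesgue_measure (A i))%E.
Proof.
elim: n A => [|n IHn] A mA.
  by rewrite big_ord0 /= diracE mem_set// => -[].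
have mB : measurable [set v : 'rV[R]_n | forall i, A (lift ord0 i) (v ord0 i)].
  rewrite (_ : [set _ | _] = \bigcap_(i in [set: 'I_n])
      ((fun v : 'rV[R]_n => v ord0 i) @^-1` A (lift ord0 i))).
    apply: fin_bigcap_measurable => // i _.
    by rewrite -[X in measurable X]setTI; exact: measurable_coord.
  by apply/seteqP; split=> v Av i; [move=> _|]; exact: Av.
rewrite big_ord_recl -IHn => [|i]; last exact: mA.
rewrite /= /lebesgue_cons /pushforward -product_measure1E//; last exact: mA.
congr (_ _); apply/seteqP; split => [[x v] /= Av|[x v] /= [Ax Av] i].
  split; first by have := Av ord0; rewrite mxE unlift_none.
  by move=> i; have := Av (lift ord0 i); rewrite mxE liftK.
by rewrite mxE; case: unliftP => [j ->|->].
Qed.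

End lebesgue_rV.
Arguments lebesgue_rV {R} n.

(* The Euclidean norm; the library's norm `|v| on row vectors is the sup norm. *)
Definition enorm (R : realType) n (v : 'rV[R]_n) : R :=
  Num.sqrt (\sum_(i < n) v ord0 i ^+ 2).

Definition eball (R : realType) n (r : R) : set 'rV[R]_n :=
  [set x | enorm x < r].

Section Gamma.
Context {R : realType} {n : nat}.
Implicit Types r : R.

Definition Gamma1 r : set ('rV[R]_n * 'rV[R]_n) :=
  eball r `*` (eball (2 * r) `\` eball r).

Definition Gamma2 r : set ('rV[R]_n * 'rV[R]_n) :=
  (eball (2 * r) `\` eball r) `*` (eball (2 * r) `\` eball r).

Definition Gamma3 r : set ('rV[R]_n * 'rV[R]_n) :=
  (eball (2 * r) `\` eball r) `*` ~` eball (2 * r).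

Definition Gamma4 r : set ('rV[R]_n * 'rV[R]_n) :=
  eball r `*` ~` eball (2 * r).

End Gamma.

Definition Cc1 (R : realType) n (eta : 'rV[R]_n -> R) : Prop :=
  [/\ forall x, differentiable eta x,
      forall v, continuous (fun x => 'D_v eta x)
    & compact (closure [set x | eta x != 0])].

Section principal_value.
Context {R : realType} {n : nat}.
Implicit Types (F : 'rV[R]_n -> 'rV[R]_n -> R) (e : R) (x : 'rV[R]_n).
Let mu : {sigma_finite_measure set 'rV[R]_n -> \bar R} := lebesgue_rV n.

Definition truncated_inner F e x : R :=
  \int[mu]_(z in [set z | e <= enorm (z - x)]) F x z.

Definition pv_inner F x : R := lim (truncated_inner F e x @[e --> 0^'+]).

Definition pv_integral F : R := \int[mu]_x pv_inner F x.

(* When the iterated integral pv_integral is meaningful. The operators above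
   are total (non-integrable integrals and missing limits get junk values), so
   this has to be required separately: off the diagonal the integrand is
   Lebesgue integrable, the inner principal value exists for almost every x and
   is an integrable function of x. The last clause, that the outer integral may
   be exchanged with the limit defining the inner one, holds as soon as the
   truncated inner integrals are dominated (for instance, converge uniformly
   on the support of the test function); it excludes integrands whose pointwise
   principal value misses a mass concentrated on the diagonal, such as those
   coming from Green functions. *)
Definition pv_integrable F : Prop :=
  [/\ forall e, 0 < e ->
        (mu \x mu)%E.-integrable [set p | e <= enorm (p.2 - p.1)]
          (fun p => (F p.1 p.2)%:E),
      {ae mu, forall x, cvg (truncated_inner F e x @[e --> 0^'+])},
      mu.-integrable setT (fun x => (pv_inner F x)%:E)
    & \int[mu]_x truncated_inner F e x @[e --> 0^'+] --> pv_integral F].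

End principal_value.

(* Main.v *)
(** Write [w = phi_i(x) phi_i(z) J_i(x - z)], which is nonnegative and symmetric,
    and test with a cutoff [eta] equal to 1 on [B_R] and to 0 off [B_2R].
    Exchanging [x] and [z] turns the stability inequality into
      [sum_i int int w (sigma(x) - sigma(z))
                       (sigma(x) eta(x)^2 - sigma(z) eta(z)^2) <= 0],
    and Young's inequality then bounds
      [int int w (sigma(x) - sigma(z))^2 (eta(x)^2 + eta(z)^2)]
    by an error supported where [eta(x) <> eta(z)], hence (up to exchanging [x]
    and [z]) on the sets Gamma_R^k.  There [|eta(x) - eta(z)| <= C |x - z| / R],
    so the growth hypothesis bounds the error.  A first pass shows that the
    energy [int int w (sigma(x) - sigma(z))^2] is finite; a second one, with the
    energy outside [B_R x B_R] now tending to 0, shows that it vanishes.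
    Hence [sigma(x) = sigma(x - y)] for almost every [x], for almost every [y]
    with [J(y) <> 0].  The set of such periods [y] is a measurable subgroup of
    positive measure, and by Steinhaus it is all of [R^n]. *)
Require Import Defs.
From mathcomp Require Import all_boot all_order all_algebra.
From mathcomp Require Import all_classical all_reals all_analysis.
From mathcomp Require Import measurable_realfun ring lra.
Import Order.TTheory GRing.Theory Num.Theory.
Import numFieldNormedType.Exports.
Local Open Scope classical_set_scope.
Local Open Scope ring_scope.

Set Implicit Arguments.
Unset Strict Implicit.

(** * Lebesgue measure: invariance and periods *)

(** The preimage of a half-open interval is an interval of the same length, and Lebesgue measure is
    the only measure with these values on half-open intervals. *)
Lemma lebesgue_measure_reflection (R : realType) (a : R)
    (A : set (measurableTypeR R)) : measurable A ->
  lebesgue_measure ((fun t : measurableTypeR R => a - t : measurableTypeR R)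
                      @^-1` A) = lebesgue_measure A.
Proof.
move=> mA.
have mf : measurable_fun setT
    (fun t : measurableTypeR R => a - t : measurableTypeR R).
  by apply: measurable_funB; [exact: measurable_cst|exact: measurable_id].
pose m' := measure_function_pushforward__canonical__measure_function_Measure
  (@lebesgue_measure R) mf.
apply/esym; apply: (@lebesgue_measure_unique R m' _ A mA).
move=> _ [[x y]] /= xy <-; rewrite /pushforward.
have -> : (fun t : measurableTypeR R => a - t : measurableTypeR R)
    @^-1` `]x, y] = `[a - y, a - x[%classic.
  apply/seteqP; split=> t /=; rewrite !in_itv/=; lra.
rewrite !lebesgue_measure_itv/= !lte_fin ltrD2l ltrN2; case: ifPn => // _.
by rewrite -!EFinB; congr (_%:E); lra.
Qed.

(** The reflections [t -> - t] and [t -> a - t] compose to a translation. *)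
Lemma lebesgue_measure_translation (R : realType) (a : R)
    (A : set (measurableTypeR R)) : measurable A ->
  lebesgue_measure ((fun t : measurableTypeR R => t - a : measurableTypeR R)
                      @^-1` A) = lebesgue_measure A.
Proof.
move=> mA; rewrite -[RHS](lebesgue_measure_reflection 0 mA).
set B := (X in _ = lebesgue_measure X).
have mB : measurable B.
  rewrite -[B]setTI; apply: measurable_funB => //.
rewrite -(lebesgue_measure_reflection a mB); congr lebesgue_measure.
by apply/funext => t; rewrite /B /=; congr A; rewrite sub0r opprB.
Qed.

(** Around a density point, [A] fills more than 3/4 of some ball of radius [r]. For [|t| < r / 2],
    this portion and its translate by [t] lie in an interval of length [3r] while their measures add
    up to more than [3r], so they meet. *)
Lemma steinhaus (R : realType) (A : set (measurableTypeR R)) :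
  measurable A -> (0 < lebesgue_measure A)%E ->
  exists2 e : R, 0 < e &
    forall t, `|t| < e -> exists a b, [/\ A a, A b & t = a - b].
Proof.
move=> mA A0.
have [x [Ax dx]] : exists x : R, A x /\
    (lebesgue_measure (A `&` ball x r) * (lebesgue_measure (ball x r))^-1)%E
      @[r --> (0:R)^'+] --> 1%:E.
  apply: contrapT => nx.
  have [N [mN N0 AN]] := lebesgue_density mA.
  suff : (lebesgue_measure A <= lebesgue_measure N)%E by rewrite N0 leNgt A0.
  apply: le_measure; rewrite ?inE// => x Ax; apply: AN => /= dx.
  by apply: nx; exists x; split=> //; move: dx; rewrite indicE mem_set.
have : \forall r \near (0:R)^'+, (((3/4)%:E : \bar R) <
    lebesgue_measure (A `&` ball x r) * (lebesgue_measure (ball x r))^-1)%E.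
  apply: (dx [set y | ((3/4)%:E < y)%E]); apply: open_ereal_gt'.
  by rewrite lte_fin; lra.
move=> near1; have [r [r0 rr]] : exists r : R, 0 < r /\ ((3/4)%:E <
    lebesgue_measure (A `&` ball x r) * (lebesgue_measure (ball x r))^-1)%E.
  near (0:R)^'+ => r; exists r; split; near: r => //.
  exact: nbhs_right_gt.
have mE : measurable (A `&` ball x r : set (measurableTypeR R)).
  by apply: measurableI => //; exact: measurable_ball.
set E := A `&` ball x r in rr mE.
have mEoo : (lebesgue_measure E <= (r *+ 2)%:E)%E.
  rewrite -(lebesgue_measure_ball x (ltW r0)); apply: le_measure.
  - by rewrite inE.
  - by rewrite inE; exact: measurable_ball.
  - by move=> ? [].
have finE : lebesgue_measure E \is a fin_num.
  by rewrite ge0_fin_numE//; apply: le_lt_trans mEoo _; rewrite ltry.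
have mE32 : 3 / 2 * r < fine (lebesgue_measure E).
  move: rr; rewrite lebesgue_measure_ball ?ltW// inver mulrn_eq0/= gt_eqF//.
  rewrite -(fineK finE) -EFinM lte_fin ltr_pdivlMr ?mulrn_wgt0//.
  rewrite -mulr_natr; lra.
exists (r / 2) => [|t tr]; first lra.
pose E' := (fun s : measurableTypeR R => s - t : measurableTypeR R) @^-1` E.
have mE' : measurable E'.
  by rewrite -[E']setTI; apply: measurable_funB => //; exact: measurable_id.
have [EE0|[s [[As _] [As' _]]]] : E `&` E' = set0 \/ (E `&` E') !=set0.
  by have [|/eqP] := eqVneq (E `&` E') set0; [left|right; apply/set0P/eqP].
- have : (lebesgue_measure (E `|` E') <= lebesgue_measure (ball x (r + r / 2)))%E.
    apply: le_measure.
    + by rewrite inE; exact: measurableU.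
    + by rewrite inE; exact: measurable_ball.
    + move=> y [[_]|[_]]; rewrite /ball/=; first by move/lt_trans; apply; lra.
      move=> h.
      have := ler_normD (x - (y - t)) (- t).
      rewrite normrN (_ : x - (y - t) - t = x - y); last lra.
      lra.
  have -> : (lebesgue_measure (E `|` E') =
      lebesgue_measure E + lebesgue_measure E)%E.
    rewrite measureU//; congr (_ + _)%E.
    exact: (lebesgue_measure_translation t mE).
  rewrite lebesgue_measure_ball; last lra.
  rewrite -(fineK finE) -EFinD lee_fin -mulr_natr; lra.
- exists s, (s - t); split => //; lra.
Unshelve. all: by end_near.
Qed.

(** * Reflections and translations of Lebesgue measure on R^n *)

Lemma measurable_coord_fun (R : realType) d (T : measurableType d) n
    (f : T -> 'rV[R]_n) (i : 'I_n) :
  measurable_fun setT f -> measurable_fun setT (fun x => f x ord0 i).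
Proof. by move=> mf; exact: (measurableT_comp (measurable_coord i) mf). Qed.

Lemma measurable_rVB (R : realType) d (T : measurableType d) n
    (f g : T -> 'rV[R]_n) :
  measurable_fun setT f -> measurable_fun setT g ->
  measurable_fun setT (fun x => f x - g x).
Proof.
move=> mf mg; apply: measurable_fun_coordP => i.
under eq_fun do rewrite !mxE.
by apply: measurable_funB; exact: measurable_coord_fun.
Qed.

Lemma lebesgue_rVS (R : realType) n (A : set 'rV[R]_n.+1) :
  lebesgue_rV n.+1 A =
  (@lebesgue_measure R \x lebesgue_rV n)%E (@rV_cons R n @^-1` A).
Proof. by []. Qed.

(** By induction: the reflection acts separately on the first coordinate and on the rest, so the
    pushforward agrees with the product measure on rectangles, which determine it. *)
Lemma lebesgue_rV_reflection (R : realType) n (v : 'rV[R]_n) (A : set 'rV[R]_n) :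
  measurable A ->
  lebesgue_rV n ((fun z => v - z) @^-1` A) = lebesgue_rV n A.
Proof.
elim: n v A => [|n IHn] v A mA.
  congr (lebesgue_rV 0 _); apply/seteqP.
  by split=> z /=; rewrite (_ : v - z = z)//; apply/rowP => -[].
pose f (p : measurableTypeR R * 'rV[R]_n) : measurableTypeR R * 'rV[R]_n :=
  (v ord0 ord0 - p.1, \row_i v ord0 (lift ord0 i) - p.2).
have mf : measurable_fun setT f.
  apply/measurable_fun_pairP; split.
    by apply: measurable_funB; [exact: measurable_cst|exact: measurable_fst].
  by apply: measurable_rVB; [exact: measurable_cst|exact: measurable_snd].
pose m' := measure_function_pushforward__canonical__measure_function_Measure
  (@lebesgue_measure R \x lebesgue_rV n)%E mf.
have mA' : measurable (@rV_cons R n @^-1` A).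
  by rewrite -[X in measurable X]setTI; exact: measurable_rV_cons.
rewrite !lebesgue_rVS.
have -> : @rV_cons R n @^-1` ((fun z => v - z) @^-1` A) =
    f @^-1` (@rV_cons R n @^-1` A).
  apply/seteqP; split=> p /=; rewrite (_ : v - rV_cons p = rV_cons (f p))//;
    apply/rowP => i; rewrite !mxE; case: unliftP => [j ->|->] /=; by rewrite ?mxE.
apply/esym; rewrite -[RHS]/(m' (@rV_cons R n @^-1` A)).
apply: product_measure_unique => // B C mB mC.
transitivity ((@lebesgue_measure R \x lebesgue_rV n)%E (f @^-1` (B `*` C))) => //.
rewrite (_ : f @^-1` (B `*` C) =
  ((fun t : measurableTypeR R => v ord0 ord0 - t : measurableTypeR R) @^-1` B)
  `*` ((fun z => \row_i v ord0 (lift ord0 i) - z) @^-1` C))//.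
rewrite product_measure1E.
- congr (_ * _)%E; last exact: IHn.
  exact: lebesgue_measure_reflection.
- rewrite -[X in measurable X]setTI; apply: measurable_funB => //.
- by rewrite -[X in measurable X]setTI; apply: measurable_rVB.
Qed.

Lemma lebesgue_rV_translation (R : realType) n (v : 'rV[R]_n)
    (A : set 'rV[R]_n) : measurable A ->
  lebesgue_rV n ((fun z => z - v) @^-1` A) = lebesgue_rV n A.
Proof.
move=> mA; rewrite -[RHS](lebesgue_rV_reflection 0 mA).
set B := (X in _ = lebesgue_rV n X).
have mB : measurable B.
  by rewrite -[B]setTI; apply: measurable_rVB.
rewrite -(lebesgue_rV_reflection v mB); congr (_ _).
by apply/funext => t; rewrite /B /=; congr A; rewrite sub0r opprB.
Qed.

(** * Subgroups of R^n of positive measure *)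

Lemma subgroup_full_R (R : realType) (Q : set R) (e : R) :
  (forall x y, Q x -> Q y -> Q (x - y)) ->
  0 < e -> (forall t, `|t| < e -> Q t) -> Q = setT.
Proof.
move=> QB e0 Qe; rewrite -subTset => t _.
have Q0 : Q 0 by apply: Qe; rewrite normr0.
have QD x y : Q x -> Q y -> Q (x + y).
  by move=> Qx Qy; rewrite -(opprK y); apply: (QB) => //; rewrite -sub0r; exact: QB.
have QX x k : Q x -> Q (x *+ k).
  by move=> Qx; elim: k => [|k IHk]; rewrite ?mulr0n// mulrS; exact: QD.
(* Archimedean argument: [t] is a multiple of [t / (k + 1)], which is smaller than [e]. *)
pose k := Num.truncn (`|t| / e).
have kt : `|t| / e < k.+1%:R by exact: truncnS_gt.
rewrite -(@divfK _ k.+1%:R _ t) ?pnatr_eq0// mulr_natr.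
apply/QX/Qe; rewrite normrM normfV (ger0_norm (ler0n _ _)).
by rewrite ltr_pdivrMr// mulrC -ltr_pdivrMr.
Qed.

(* Induction on [n]: a one-dimensional slice of [P] of positive measure shows,
   by Steinhaus, that [P] contains the first coordinate axis; all slices of [P]
   orthogonal to that axis then coincide. *)
Lemma subgroup_full_rV (R : realType) n (P : set 'rV[R]_n) :
  measurable P -> (forall x y, P x -> P y -> P (x - y)) ->
  (0 < lebesgue_rV n P)%E -> P = setT.
Proof.
elim: n P => [|n IHn] P mP PB P0; rewrite -subTset => x _.
  have [y Py] : P !=set0.
    by apply/set0P; apply: contraL P0 => /eqP ->; rewrite measure0 ltxx.
  by rewrite (_ : x = y)//; apply/rowP => -[].
pose P' := @rV_cons R n @^-1` P.
have mP' : measurable P' by rewrite -[P']setTI; exact: measurable_rV_cons.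
have P'B p q : P' p -> P' q -> P' (p.1 - q.1, p.2 - q.2).
  rewrite /P' /= => Pp Pq; rewrite (_ : rV_cons _ = rV_cons p - rV_cons q); first exact: PB.
  by apply/rowP => i; rewrite !mxE; case: unliftP => [j|] _; rewrite ?mxE.
have P'0 : (0 < (@lebesgue_measure R \x lebesgue_rV n) P')%E by [].
have axis (t : R) : P' (t, 0).
  have [w Pw] : exists w, (0 < lebesgue_measure (ysection P' w))%E.
    apply: contrapT => nw; move: P'0.
    (* The product measure integrates over the first coordinate; the order is exchanged so that
       one-dimensional slices appear. *)
    have -> : (@lebesgue_measure R \x lebesgue_rV n)%E P' =
        (@lebesgue_measure R \x^ lebesgue_rV n)%E P'.
      by apply: product_measure_unique => // A B mA mB; rewrite /= product_measure2E.
    rewrite /= /product_measure2 integral0_eq ?ltxx// => w _ /=.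
    apply/eqP; rewrite eq_le measure_ge0 andbT leNgt; apply/negP => h.
    by apply: nw; exists w.
  have [e e0 Ae] := steinhaus (measurable_ysection w mP') Pw.
  have : [set t : R | P' (t, 0)] = setT.
    apply: (@subgroup_full_R _ _ e) => // [y z /= Py Pz|s /Ae[a [b [Aa Ab ->]]]].
      by have := P'B _ _ Py Pz; rewrite /= subr0.
    move: Aa Ab; rewrite /ysection/= !inE => Aa Ab.
    by have := P'B _ _ Aa Ab; rewrite /= subrr.
  by move/seteqP => [_ /(_ t)]; exact.
have : xsection P' 0 = setT.
  apply: IHn => [|y z|]; first exact: measurable_xsection.
    rewrite /xsection/= !inE => Py Pz.
    by have := P'B _ _ Py Pz; rewrite /= subr0.
  have [s Ps] : exists s, (0 < lebesgue_rV n (xsection P' s))%E.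
    apply: contrapT => ns; move: P'0.
    rewrite /= /product_measure1 integral0_eq ?ltxx// => s _ /=.
    apply/eqP; rewrite eq_le measure_ge0 andbT leNgt; apply/negP => h.
    by apply: ns; exists s.
  rewrite (_ : xsection P' 0 = xsection P' s)//; apply/seteqP; split=> y.
    rewrite /xsection/= !inE => Py.
    have := P'B _ _ Py (axis (- s)).
    by rewrite /= sub0r opprK subr0.
  rewrite /xsection/= !inE => Py.
  have := P'B _ _ Py (axis s).
  by rewrite /= subrr subr0.
move/seteqP => [_ full].
have -> : x = rV_cons (rV_uncons x).
  by apply/rowP => i; rewrite !mxE; case: unliftP => [j ->|->]; rewrite ?mxE.
have := full (- (rV_uncons x).2) I; rewrite /xsection/= inE => xfull.
have := P'B _ _ (axis (rV_uncons x).1) xfull.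
by rewrite /P' /= subr0 sub0r opprK.
Qed.

(** * Null sets of a product and their sections *)

Section null_sections.
Context d1 d2 (T1 : measurableType d1) (T2 : measurableType d2) (R : realType).
Variables (m1 : {sigma_finite_measure set T1 -> \bar R})
  (m2 : {sigma_finite_measure set T2 -> \bar R}).
Variables (A : set (T1 * T2)) (mA : measurable A).

(** The product measure of [A] integrates the measures of its sections, and a nonnegative function
    has integral 0 exactly when it vanishes almost everywhere. *)
Lemma ae_null_xsectionP : (m1 \x m2)%E A = 0%E <->
  {ae m1, forall x, m2 (xsection A x) = 0%E}.
Proof.
have mF : measurable_fun setT (m2 \o xsection A) by exact: measurable_fun_xsection.
have -> : (m1 \x m2)%E A = (\int[m1]_x `|(m2 \o xsection A) x|)%E.
  by apply: eq_integral => x _; rewrite gee0_abs//= measure_ge0.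
rewrite (ae_eq_integral_abs m1 measurableT mF).
by split; apply: filterS => x /=; [apply|].
Qed.

Lemma ae_null_ysectionP : (m1 \x m2)%E A = 0%E <->
  {ae m2, forall y, m1 (ysection A y) = 0%E}.
Proof.
have mF : measurable_fun setT (m1 \o ysection A) by exact: measurable_fun_ysection.
have -> : (m1 \x m2)%E A = (m1 \x^ m2)%E A.
  by apply: product_measure_unique => // B C mB mC; rewrite /= product_measure2E.
have -> : (m1 \x^ m2)%E A = (\int[m2]_y `|(m1 \o ysection A) y|)%E.
  by apply: eq_integral => y _; rewrite gee0_abs//= measure_ge0.
rewrite (ae_eq_integral_abs m2 measurableT mF).
by split; apply: filterS => x /=; [apply|].
Qed.

End null_sections.

Lemma measurable_cube (R : realType) n (x : 'rV[R]_n) (e : R) :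
  measurable [set v : 'rV[R]_n | forall i, ball (x ord0 i) e (v ord0 i)].
Proof.
rewrite (_ : [set _ | _] = \bigcap_(i in [set: 'I_n])
    ((fun v : 'rV[R]_n => v ord0 i) @^-1` ball (x ord0 i) e)).
  apply: fin_bigcap_measurable => // i _.
  by rewrite -[X in measurable X]setTI; apply: measurable_coord => //;
    exact: measurable_ball.
by apply/seteqP; split=> v Av i; [move=> _|]; exact: Av.
Qed.

Lemma lebesgue_rV_cube_gt0 (R : realType) n (x : 'rV[R]_n) (e : R) : 0 < e ->
  (0 < lebesgue_rV n [set v | forall i, ball (x ord0 i) e (v ord0 i)])%E.
Proof.
move=> e0; rewrite (lebesgue_rV_box (A := fun i => ball (x ord0 i) e)) => [|i].
  elim/big_ind: _ => // [y z y0 z0|i _]; first exact: mule_gt0.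
  by rewrite lebesgue_measure_ball ?ltW// lte_fin mulrn_wgt0.
exact: measurable_ball.
Qed.

Lemma measurable_neq_set (R : realType) d (T : measurableType d) (f g : T -> R) :
  measurable_fun setT f -> measurable_fun setT g ->
  measurable [set x | f x <> g x].
Proof.
move=> mf mg; rewrite (_ : [set _ | _] = (fun x => f x == g x) @^-1` [set false]).
  by rewrite -[X in measurable X]setTI; apply: measurable_fun_eqr.
by apply/seteqP; split=> x /=; [by move/eqP/negbTE|move=> fg; apply/eqP; rewrite fg].
Qed.

(** * Periods of a function and almost everywhere constancy *)

Section periods.
Context {R : realType} {n : nat}.
Local Notation mu := (lebesgue_rV n).
Variables sigma J : 'rV[R]_n -> R.
Hypotheses (msigma : measurable_fun setT sigma) (mJ : measurable_fun setT J).
Hypothesis Jneq0 : ~ {ae mu, forall y, J y = 0}.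
Hypothesis sigmaJ :
  (mu \x mu)%E [set p | J (p.1 - p.2) <> 0 /\ sigma p.1 <> sigma p.2] = 0%E.

Lemma ae_constant_of_periods : exists c, {ae mu, forall x, sigma x = c}.
Proof.
have m2 : measurable_fun setT (fun p : 'rV[R]_n * 'rV[R]_n => p.1 - p.2).
  by apply: measurable_rVB; [exact: measurable_fst|exact: measurable_snd].
pose M := [set p : 'rV[R]_n * 'rV[R]_n | sigma p.1 <> sigma (p.1 - p.2)].
have mM : measurable M.
  by apply: measurable_neq_set; apply: measurableT_comp => //; exact: measurable_fst.
(* [P] is the set of periods: those [y] with [sigma x = sigma (x - y)] for almost every [x]. *)
pose P := [set y | mu (ysection M y) = 0%E].
have mP : measurable P.
  rewrite (_ : P = (mu \o ysection M) @^-1` [set 0%E])//.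
  by rewrite -[X in measurable X]setTI; exact: measurable_fun_ysection.
have PB y z : P y -> P z -> P (y - z).
  rewrite /P /= => Py Pz; apply/eqP; rewrite -measure_le0.
  (* Both [sigma x] and [sigma (x - (y - z))] are compared with [sigma (x - y)]; the second
     comparison fails only on a translate of the null set attached to [z]. *)
  pose B := (fun x => x - (y - z)) @^-1` ysection M z.
  have mB : measurable B.
    rewrite -[B]setTI; apply: measurable_rVB => //.
    exact: measurable_ysection.
  have B0 : mu B = 0%E by rewrite lebesgue_rV_translation//; exact: measurable_ysection.
  apply: (@le_trans _ _ (mu (ysection M y `|` B))).
    apply: le_measure; rewrite ?inE; first exact: measurable_ysection.
      by apply: measurableU => //; exact: measurable_ysection.
    move=> x /ysectionP xyz.
    have [xy|?] := pselect (sigma x = sigma (x - y)); [right|by left; apply/ysectionP].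
    apply/ysectionP => e; apply: xyz; rewrite /= e xy; congr sigma.
    by rewrite /= -addrA -opprD subrK.
  have mMy : measurable (ysection M y) by exact: measurable_ysection.
  have : (mu (ysection M y `|` B) <= mu (ysection M y) + mu B)%E.
    exact: (measureU2 mu mMy mB).
  by rewrite Py B0 adde0.
pose N := [set p : 'rV[R]_n * 'rV[R]_n | J (p.1 - p.2) <> 0 /\ sigma p.1 <> sigma p.2].
have mN : measurable N.
  apply: (measurableI [set p | J (p.1 - p.2) <> 0]); apply: measurable_neq_set => //.
  - exact: measurableT_comp.
  - by apply: measurableT_comp => //; exact: measurable_fst.
  - by apply: measurableT_comp => //; exact: measurable_snd.
pose N' := [set p : 'rV[R]_n * 'rV[R]_n | J p.2 <> 0] `&` M.
have mN' : measurable N'.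
  apply: measurableI => //; apply: measurable_neq_set => //.
  by apply: measurableT_comp => //; exact: measurable_snd.
(* For fixed [x], the measure-preserving substitution [z = x - y] carries sections of [N] to
   sections of [N']. *)
have N'0 : (mu \x mu)%E N' = 0%E.
  apply/ae_null_xsectionP => //.
  have /ae_null_xsectionP := sigmaJ; move/(_ mN); apply: filterS => x.
  rewrite -(lebesgue_rV_reflection x); last exact: measurable_xsection.
  congr (mu _ = _); apply/seteqP; split=> y.
    move=> /= /xsectionP[]/=; rewrite opprB addrC subrK => Jy xy.
    by apply/xsectionP.
  move=> /xsectionP[]/= Jy xy; apply/xsectionP.
  by rewrite /N /= opprB addrC subrK.
(* Almost every [y] has a null section of [N']. Where [J y <> 0] this is the section of [M], so [y]
   is a period; a null [P] would thus make [J] vanish almost everywhere. *)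
have P0 : (0 < mu P)%E.
  rewrite lt_neqAle measure_ge0 andbT; apply/eqP => P0.
  apply: Jneq0; have /ae_null_ysectionP := N'0; move/(_ mN').
  have PN : {ae mu, forall y, ~ P y}.
    by exists P; split => // y /= /contrapT.
  apply: filterS2 PN => y nPy N'y; apply: contrapT => Jy; apply: nPy.
  rewrite /P /= -N'y; congr (mu _); apply/seteqP; split=> x /ysectionP.
    by move=> Mxy; apply/ysectionP.
  by move=> [_ Mxy]; apply/ysectionP.
have PT := subgroup_full_rV mP PB P0.
(* Every [y] is now a period, so [M] is null. Slicing it the other way gives one point [x] with
   [sigma x = sigma (x - y)] for almost every [y], and a reflection turns [x - y] into an arbitrary
   point. *)
have : (mu \x mu)%E M = 0%E.
  apply/ae_null_ysectionP => //; apply: aeW => y.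
  by have : [set: 'rV[R]_n] y by []; rewrite -PT.
move/ae_null_xsectionP => /(_ mM) [B [mB B0 MB]].
have [x Bx] : exists x, ~ B x.
  apply: contrapT => nB; have := lebesgue_rV_cube_gt0 (0 : 'rV[R]_n) ltr01.
  apply/negP; rewrite -leNgt -B0; apply: le_measure; rewrite ?inE//.
  - by apply: measurable_cube.
  - by move=> v _; apply: contrapT => nBv; apply: nB; exists v.
have xM0 : mu (xsection M x) = 0%E by apply: contrapT => ?; apply: Bx; exact: MB.
exists (sigma x); exists [set z | sigma z <> sigma x]; split => //.
- exact: measurable_neq_set.
- rewrite -xM0 -(lebesgue_rV_reflection x (measurable_xsection x mM)).
  congr (mu _); apply/seteqP; split=> z.
    by move=> /= zx; apply/xsectionP; rewrite /M /= opprB addrC subrK => /esym.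
  by move=> /xsectionP; rewrite /M /= opprB addrC subrK => xz /esym.
Qed.
End periods.

(** The set where [f] differs from [c] is open; if nonempty it would contain a cube, which has
    positive measure. *)
Lemma continuous_ae_constant (R : realType) n (f : 'rV[R]_n -> R) (c : R) :
  {ae lebesgue_rV n, forall x, f x = c} -> continuous f -> forall x, f x = c.
Proof.
move=> [B [mB B0 fB]] cf x; apply: contrapT => fxc.
have : \forall y \near x, f y != c.
  apply: (cf x [set z | z != c]); apply: open_nbhs_nbhs; split; last exact/eqP.
  exact: open_neq.
move=> /nbhs_ballP[e /= e0 xe].
have := lebesgue_rV_cube_gt0 x e0; apply/negP; rewrite -leNgt -B0.
apply: le_measure; rewrite ?inE//; first exact: measurable_cube.
by move=> y xy; apply: fB => /=; apply/eqP; apply: xe; split => // i j; rewrite (ord1 i).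
Qed.
(** * A C^1 cutoff function *)

Section continuously_differentiable.
Context {R : realType} {V : normedModType R}.
Implicit Types (f g : V -> R) (h : R -> R).

(** The regularity half of [Cc1], over any normed space, so that closure under sums, products and
    composition can be proved separately from compact support. *)
Definition continuously_differentiable f :=
  (forall x, differentiable f x) /\
  (forall v, continuous (fun x => 'D_v f x)).

Lemma continuously_differentiable_cst (c : R) :
  continuously_differentiable (cst c).
Proof.
split=> [x|v]; first exact: differentiable_cst.
by under eq_fun do rewrite derive_cst; exact: cst_continuous.
Qed.

Lemma continuously_differentiableD f g :
  continuously_differentiable f -> continuously_differentiable g ->
  continuously_differentiable (f + g).
Proof.
move=> [df cf] [dg cg]; split=> [x|v]; first exact: differentiableD.
have -> : (fun x => 'D_v (f + g) x) = (fun x => 'D_v f x + 'D_v g x).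
  by apply/funext => x; rewrite deriveD//; exact: diff_derivable.
by move=> x; apply: cvgD; [exact: cf|exact: cg].
Qed.

Lemma continuously_differentiableM f g :
  continuously_differentiable f -> continuously_differentiable g ->
  continuously_differentiable (f * g).
Proof.
move=> [df cf] [dg cg]; split=> [x|v]; first exact: differentiableM.
have -> : (fun x => 'D_v (f * g) x) =
    (fun x => f x * 'D_v g x + g x * 'D_v f x).
  by apply/funext => x; rewrite deriveM//; exact: diff_derivable.
move=> x; apply: cvgD; apply: cvgM; [|exact: cg| |exact: cf].
  exact: differentiable_continuous.
exact: differentiable_continuous.
Qed.

Lemma continuously_differentiable_sum (I : Type) (s : seq I) (f : I -> V -> R) :
  (forall i, continuously_differentiable (f i)) ->
  continuously_differentiable (\sum_(i <- s) f i).
Proof.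
move=> fC1; elim/big_ind: _ => //.
- exact: continuously_differentiable_cst.
- exact: continuously_differentiableD.
Qed.

Lemma continuously_differentiable_comp h (h' : R -> R) f :
  (forall t, is_derive t (1 : R) h (h' t)) -> continuous h' ->
  continuously_differentiable f -> continuously_differentiable (h \o f).
Proof.
move=> dh ch [df cf].
have dh1 t : differentiable h t by apply/derivable1_diffP; have [] := dh t.
split=> [x|v]; first exact: differentiable_comp.
have -> : (fun x => 'D_v (h \o f) x) = (fun x => 'D_v f x * h' (f x)).
  apply/funext => x; rewrite deriveE; last exact: differentiable_comp.
  have dh1x : 'd h (f x) (1 : R) = h' (f x).
    by rewrite -deriveE//; have [_ ->] := dh (f x).
  rewrite diff_comp//= (deriveE _ (df x)); set y : R := 'd f x v.
  by rewrite -[X in 'd h _ X](mulr1 y : y *: (1 : R) = y) linearZ dh1x.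
move=> x; apply: cvgM; first exact: cf.
apply: continuous_comp; first exact: differentiable_continuous.
exact: ch.
Qed.

End continuously_differentiable.

Lemma continuously_differentiable_coord (R : realType) n (i : 'I_n) :
  continuously_differentiable (fun x : 'rV[R]_n => x ord0 i).
Proof.
split=> [x|v]; first exact: differentiable_coord.
have -> : (fun x => 'D_v (fun x : 'rV[R]_n => x ord0 i) x) =
    cst ('D_v (fun x : 'rV[R]_n => x ord0 i) 0).
  apply/funext => x; rewrite /derive /=.
  apply: (congr1 (fun F : R -> R => lim (F h @[h --> 0^']))).
  by apply/funext => h; rewrite !mxE addr0 subr0 addrK.
exact: cst_continuous.
Qed.

(* The squared positive part is C^1, unlike the positive part itself. *)
Definition sqpos (R : realType) (t : R) : R := Num.max t 0 ^+ 2.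

Lemma is_derive_sqpos (R : realType) (t : R) :
  is_derive t (1 : R) (@sqpos R) (2 * Num.max t 0).
Proof.
(* The first-order Taylor error is at most [h ^+ 2] even across the kink at 0, so the difference
   quotient is within [|h|] of its limit. *)
have bound (h : R) : `|sqpos (h + t) - sqpos t - h * (2 * Num.max t 0)| <= h ^+ 2.
  rewrite /sqpos ler_norml /Num.max; case: ltP => ht; case: ltP => t0; nra.
have : h^-1 *: (sqpos (h *: 1 + t) - sqpos t) @[h --> (0:R)^'] --> 2 * Num.max t 0.
  apply/cvgrPdist_le => e e0; near=> h.
  have h0 : h != 0 by near: h; exact: nbhs_dnbhs_neq.
  have he : `|h| <= e by near: h; apply: dnbhs0_le.
  rewrite distrC; have -> : h^-1 *: (sqpos (h *: 1 + t) - sqpos t) - 2 * Num.max t 0 =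
    h^-1 * (sqpos (h + t) - sqpos t - h * (2 * Num.max t 0)).
    by rewrite [h *: 1]mulr1 mulrBr mulKf.
  rewrite normrM normfV ler_pdivrMl ?normr_gt0//; apply: le_trans (bound h) _.
  by rewrite -real_normK ?num_real// expr2 ler_wpM2l.
move=> dt; split; first by apply/cvg_ex; exists (2 * Num.max t 0).
exact: cvg_lim.
Unshelve. all: by end_near.
Qed.

Lemma continuous_sqpos_derivative (R : realType) :
  continuous (fun t : R => 2 * Num.max t 0).
Proof.
move=> t; apply: cvgM; first exact: cvg_cst.
apply: continuous_max; [exact: cvg_id|exact: cvg_cst].
Qed.

(** * The Euclidean norm *)

Section enorm_theory.
Context {R : realType} {n : nat}.
Implicit Types x y z : 'rV[R]_n.

Lemma enorm_ge0 x : 0 <= enorm x.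
Proof. exact: sqrtr_ge0. Qed.

Lemma sqr_enorm x : enorm x ^+ 2 = \sum_(i < n) x ord0 i ^+ 2.
Proof. by rewrite sqr_sqrtr// sumr_ge0// => i _; exact: sqr_ge0. Qed.

Lemma enormN x : enorm (- x) = enorm x.
Proof. by congr Num.sqrt; apply: eq_bigr => i _; rewrite mxE sqrrN. Qed.

Lemma enorm_distC x y : enorm (x - y) = enorm (y - x).
Proof. by rewrite -enormN opprB. Qed.

Lemma enorm_eq0 x : enorm x = 0 -> x = 0.
Proof.
move=> x0; have := sqr_enorm x; rewrite x0 expr0n/= => /esym/eqP.
rewrite psumr_eq0 => [/allP xi0|i _]; last exact: sqr_ge0.
apply/rowP => i; rewrite mxE; apply/eqP; rewrite -sqrf_eq0.
by apply: xi0; rewrite mem_index_enum.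
Qed.

Lemma ler_coord_enorm x i : `|x ord0 i| <= enorm x.
Proof.
rewrite -(ler_pXn2r (_ : (0 < 2)%N)) ?nnegrE ?enorm_ge0//.
rewrite sqr_enorm real_normK ?num_real// (bigD1 i)//= lerDl.
by rewrite sumr_ge0// => j _; exact: sqr_ge0.
Qed.

Lemma measurable_enorm d (T : measurableType d) (f : T -> 'rV[R]_n) :
  measurable_fun setT f -> measurable_fun setT (fun t => enorm (f t)).
Proof.
move=> mf; apply: (measurableT_comp (continuous_measurable_fun (@sqrt_continuous R))).
apply: measurable_sum => i; apply: measurable_funX.
exact: measurable_coord_fun.
Qed.

Lemma measurable_eball r : measurable (eball r : set 'rV[R]_n).
Proof.
rewrite (_ : eball r = (fun x : 'rV[R]_n => enorm x < r) @^-1` [set true])//.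
rewrite -[X in measurable X]setTI; apply: measurable_fun_ltr => //.
exact: measurable_enorm.
Qed.

End enorm_theory.

Lemma sqpos_ge0 (R : realType) (t : R) : 0 <= sqpos t.
Proof. exact: sqr_ge0. Qed.

(** Factor the difference of squares: the positive part is 1-Lipschitz, and the two positive parts
    add up to at most [2 * M]. *)
Lemma sqpos_lipschitz (R : realType) (M a b : R) : 0 <= M -> a <= M -> b <= M ->
  `|sqpos a - sqpos b| <= 2 * M * `|a - b|.
Proof.
move=> M0 aM bM; rewrite /sqpos subr_sqr normrM [leRHS]mulrC.
apply: ler_pM => //.
  rewrite /Num.max; case: ltP => a0; case: ltP => b0; rewrite ?subrr ?normr0//.
  - by rewrite sub0r normrN ger0_norm// ler0_norm; lra.
  - by rewrite subr0 !ger0_norm; lra.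
by rewrite ger0_norm /Num.max; case: ltP => a0; case: ltP => b0; lra.
Qed.

(** * The cutoff between the balls of radius r and 2r *)

Section cutoff.
Context {R : realType} {n : nat}.
Implicit Types (r : R) (x z : 'rV[R]_n).

(* [(4 - |x|^2 / r^2) / 3] is at least 1 on [B_r] and at most 0 off [B_2r]. *)
Definition cutoff r x : R :=
  1 - sqpos (1 - sqpos ((4 - (\sum_(i < n) x ord0 i ^+ 2) / r ^+ 2) / 3)).

Lemma cutoff_ge0 r x : 0 <= cutoff r x.
Proof.
rewrite /cutoff; set a := sqpos (_ / 3); have : 0 <= a := sqpos_ge0 _.
by rewrite /sqpos /Num.max; case: ltP => a1 a0; nra.
Qed.

Lemma cutoff_le1 r x : cutoff r x <= 1.
Proof. by rewrite /cutoff lerBlDr lerDl sqpos_ge0. Qed.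

Lemma cutoff_eq1 r x : 0 < r -> enorm x <= r -> cutoff r x = 1.
Proof.
move=> r0 xr; rewrite /cutoff -sqr_enorm.
have h : enorm x ^+ 2 / r ^+ 2 <= 1.
  by rewrite ler_pdivrMr ?exprn_gt0// mul1r ler_pXn2r// nnegrE ?enorm_ge0// ltW.
set s := _ / _ in h *.
have a1 : 1 <= sqpos ((4 - s) / 3).
  by rewrite /sqpos /Num.max; case: ltP => hs; [|rewrite expr2; nra]; lra.
set a := sqpos _ in a1 *.
by rewrite /sqpos (max_idPr _) ?expr0n/= ?subr0//; lra.
Qed.

Lemma cutoff_eq0 r x : 0 < r -> 2 * r <= enorm x -> cutoff r x = 0.
Proof.
move=> r0 xr; rewrite /cutoff -sqr_enorm.
have h : 4 <= enorm x ^+ 2 / r ^+ 2.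
  by rewrite ler_pdivlMr ?exprn_gt0//; nra.
rewrite {2}/sqpos (max_idPr _) ?expr0n/= ?subr0; last lra.
by rewrite /sqpos (max_idPl _) ?expr1n ?subrr.
Qed.

Lemma cutoff_Cc1 r : 0 < r -> Cc1 (cutoff r).
Proof.
move=> r0.
have [dc cc] : continuously_differentiable (cutoff r).
  have C1 (f : 'rV[R]_n -> R) : continuously_differentiable f ->
      continuously_differentiable (fun x => sqpos (f x)).
    apply: continuously_differentiable_comp; first exact: is_derive_sqpos.
    exact: continuous_sqpos_derivative.
  have C1B (f : 'rV[R]_n -> R) : continuously_differentiable f ->
      continuously_differentiable (fun x => 1 - f x).
    move=> C1f; rewrite (_ : (fun x => _) = cst 1 + cst (- 1) * f).
      apply: continuously_differentiableD; first exact: continuously_differentiable_cst.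
      apply: continuously_differentiableM => //.
      exact: continuously_differentiable_cst.
    by apply/funext => x /=; rewrite /cst !fctE mulN1r.
  (* Peeling off [1 - sqpos] twice leaves a quadratic polynomial. *)
  apply/C1B/C1/C1B/C1.
  rewrite (_ : (fun x => _) = cst (4 / 3) +
    cst (- (r ^+ 2)^-1 / 3) * \sum_(i < n)
      ((fun x : 'rV[R]_n => x ord0 i) * (fun x : 'rV[R]_n => x ord0 i))).
    apply: continuously_differentiableD; first exact: continuously_differentiable_cst.
    apply: continuously_differentiableM; first exact: continuously_differentiable_cst.
    apply: continuously_differentiable_sum => i.
    by apply: continuously_differentiableM; exact: continuously_differentiable_coord.
  apply/funext => x; rewrite !fctE fct_sumE.
  under [in RHS]eq_bigr do rewrite -expr2.
  by field; rewrite gt_eqF.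
split => //; apply: bounded_closed_compact; last exact: closed_closure.
exists (2 * r); split; first exact: num_real.
move=> M rM x.
(* Boundedness is measured in the sup norm, so the support is enclosed in a closed cube. *)
suff : closure [set x | cutoff r x != 0] `<=` [set x | forall i, `|x ord0 i| <= 2 * r].
  move=> /[apply] /= h; rewrite /Num.norm/= mx_normrE.
  apply/bigmax_leP; split => [|[i j] _]; first by apply: ltW; apply: le_lt_trans rM; lra.
  by rewrite (ord1 i)/=; exact: le_trans (h j) (ltW rM).
rewrite closureE; apply: smallest_sub => [|y /= y0 i].
  rewrite (_ : (fun _ => _) = \bigcap_(i in [set: 'I_n])
      ((fun v : 'rV[R]_n => `|v ord0 i|) @^-1` [set t | t <= 2 * r])).
    apply: closed_bigI => i _; apply: preimage_closed; last exact: closed_le.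
    move=> v _; apply: continuous_comp; last exact: norm_continuous.
    exact: coord_continuous.
  by apply/seteqP; split=> v vr i; [move=> _|]; exact: vr.
apply: le_trans (ler_coord_enorm _ _) _; rewrite leNgt; apply/negP => yr.
by move/eqP: y0; apply; apply: cutoff_eq0 => //; exact: ltW.
Qed.

(** The term [10 * n%:R] serves nearby points; the [+ 1] keeps the constant at least 1 for points at
    distance at least [r]. *)
Lemma cutoff_lipschitz r x z : 0 < r ->
  `|cutoff r x - cutoff r z| <= (10 * n%:R + 1) / r * enorm (x - z).
Proof.
move=> r0.
(* The outer [sqpos] has Lipschitz constant 2 on values at most 1, the inner one 8/3 on values at
   most 4/3, and the affine map [1 / (3 r^2)]; the product [16 / (9 r^2)] is below [2 / r^2]. *)
have lip : `|cutoff r x - cutoff r z| <=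
    2 / r ^+ 2 * `|enorm x ^+ 2 - enorm z ^+ 2|.
  rewrite !sqr_enorm /cutoff.
  set s := \sum_(i < n) _; set t := \sum_(i < n) _.
  have s0 : 0 <= s by rewrite sumr_ge0// => i _; exact: sqr_ge0.
  have t0 : 0 <= t by rewrite sumr_ge0// => i _; exact: sqr_ge0.
  have u0 (u : R) : 0 <= u -> (4 - u / r ^+ 2) / 3 <= 4 / 3.
    by move=> u0; have : 0 <= u / r ^+ 2 := divr_ge0 u0 (sqr_ge0 r); lra.
  have [s3 t3] := (u0 _ s0, u0 _ t0).
  have q1 (u : R) : 1 - sqpos u <= 1 by rewrite lerBlDr lerDl sqpos_ge0.
  have h1 := sqpos_lipschitz ler01 (q1 ((4 - t / r ^+ 2) / 3)) (q1 ((4 - s / r ^+ 2) / 3)).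
  have h2 := sqpos_lipschitz (divr_ge0 (ler0n R 4) (ler0n R 3)) s3 t3.
  have e2 : `|(4 - s / r ^+ 2) / 3 - (4 - t / r ^+ 2) / 3| =
      (r ^+ 2)^-1 / 3 * `|s - t|.
    rewrite -[in RHS](ger0_norm (_ : 0 <= (r ^+ 2)^-1 / 3)); last first.
      by rewrite divr_ge0 ?invr_ge0 ?sqr_ge0.
    by rewrite -normrM distrC; congr `| _ |; field; rewrite gt_eqF.
  move: h1 h2; rewrite e2 mulr1.
  set p := sqpos (_ / 3); set q := sqpos (_ / 3) => h1 h2.
  rewrite (_ : 1 - sqpos (1 - q) - _ = sqpos (1 - p) - sqpos (1 - q)); last by lra.
  apply: le_trans h1 _; rewrite (_ : 1 - p - (1 - q) = q - p); last by lra.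
  have : 0 <= (r ^+ 2)^-1 * `|s - t| by rewrite mulr_ge0 ?invr_ge0 ?sqr_ge0.
  lra.
have c1 : 1 <= 10 * n%:R + 1 :> R by rewrite lerDr mulr_ge0.
(* When [|x - z| >= r] the bound is trivial; otherwise either both points lie
   off [B_2r] or both have coordinates at most [3r], so that the difference of
   squares is controlled. *)
have [xzr|xzr] := leP r (enorm (x - z)).
  apply: (@le_trans _ _ 1).
    have := (cutoff_ge0 r x, cutoff_ge0 r z, cutoff_le1 r x, cutoff_le1 r z).
    by move=> [[[]]] *; rewrite ler_norml; apply/andP; split; lra.
  rewrite mulrAC ler_pdivlMr// mul1r; apply: le_trans xzr _.
  by rewrite ler_peMl ?enorm_ge0.
(* Coordinatewise, [|a_i + b_i| <= 2 |a_i| + |a_i - b_i| <= 5 r]. *)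
have diff3 (a b : 'rV[R]_n) : enorm (a - b) < r -> enorm a < 2 * r ->
    `|enorm a ^+ 2 - enorm b ^+ 2| <= n%:R * (5 * r * enorm (a - b)).
  move=> abr ar; rewrite !sqr_enorm -sumrB.
  apply: le_trans (ler_norm_sum _ _ _) _.
  rewrite -[X in X%:R * _](card_ord n) mulr_natl -sumr_const.
  apply: ler_sum => i _; rewrite subr_sqr normrM mulrC.
  have abi := ler_coord_enorm (a - b) i; rewrite !mxE in abi.
  apply: ler_pM => //.
  have ai := ler_coord_enorm a i.
  have := ler_normD (a ord0 i + a ord0 i) (- (a ord0 i - b ord0 i)).
  rewrite (_ : _ + _ - _ = a ord0 i + b ord0 i); last by lra.
  have := ler_normD (a ord0 i) (a ord0 i).
  by rewrite normrN; lra.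
have fin (d : R) : 0 <= d -> d <= n%:R * (5 * r * enorm (x - z)) ->
    2 / r ^+ 2 * d <= (10 * n%:R + 1) / r * enorm (x - z).
  move=> d0 dn; apply: (@le_trans _ _ (10 * n%:R / r * enorm (x - z))).
    have -> : 10 * n%:R / r * enorm (x - z) =
        2 / r ^+ 2 * (n%:R * (5 * r * enorm (x - z))).
      by field; rewrite gt_eqF.
    by apply: ler_wpM2l => //; rewrite divr_ge0 ?sqr_ge0.
  by rewrite ler_wpM2r ?enorm_ge0// ler_wpM2r ?invr_ge0 ?(ltW r0)// lerDl.
have [xr|xr] := ltP (enorm x) (2 * r).
  by apply: le_trans lip _; apply: fin => //; exact: diff3.
have [zr|zr] := ltP (enorm z) (2 * r).
  apply: le_trans lip _; apply: fin => //.
  by rewrite distrC (enorm_distC x); apply: diff3 => //; rewrite enorm_distC.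
by rewrite !cutoff_eq0// subrr normr0 mulr_ge0 ?enorm_ge0// divr_ge0 ?(ltW r0).
Qed.

End cutoff.
(** * Principal values and the energy estimate *)

Section integral_swap.
Local Open Scope ereal_scope.
Context d (T : measurableType d) (R : realType).
Variable m : {sigma_finite_measure set T -> \bar R}.
Implicit Type f : T * T -> \bar R.

Let mswap : measurable_fun setT (fun p : T * T => (p.2, p.1)).
Proof. exact: measurable_fun_pair. Qed.

Lemma ge0_integral_swap f : measurable_fun setT f -> (forall p, 0 <= f p) ->
  \int[m \x m]_p f (p.2, p.1) = \int[m \x m]_p f p.
Proof.
move=> mf f0; rewrite [RHS]fubini_tonelli2//.
rewrite (fubini_tonelli1 (fun p => f (p.2, p.1)))//.
exact: (measurableT_comp mf mswap).
Qed.

Lemma integrable_swap f : (m \x m).-integrable setT f ->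
  (m \x m).-integrable setT (fun p => f (p.2, p.1)).
Proof.
move=> /integrableP[mf foo]; apply/integrableP; split.
  exact: (measurableT_comp mf mswap).
rewrite (ge0_integral_swap (f := abse \o f)) => [//| |p].
  exact: measurableT_comp.
exact: abse_ge0.
Qed.

Lemma integral_swap f : (m \x m).-integrable setT f ->
  \int[m \x m]_p f (p.2, p.1) = \int[m \x m]_p f p.
Proof.
move=> intf; rewrite -[RHS]integral21_prod_meas1//.
by rewrite -[LHS]integral12_prod_meas1//; exact: integrable_swap.
Qed.

End integral_swap.

(** * From principal values to integrals off the diagonal *)

Section principal_values.
Context {R : realType} {n : nat}.
Local Notation V := ('rV[R]_n).
Local Notation mu := (lebesgue_rV n : {sigma_finite_measure set V -> \bar R}).

Definition off_diagonal (e : R) : set (V * V) :=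
  [set p | e <= enorm (p.2 - p.1)].

Lemma measurable_off_diagonal e : measurable (off_diagonal e).
Proof.
rewrite (_ : off_diagonal e =
  (fun p : V * V => e <= enorm (p.2 - p.1)) @^-1` [set true])//.
rewrite -[X in measurable X]setTI; apply: measurable_fun_ler => //.
by apply/measurable_enorm/measurable_rVB.
Qed.

(** Fubini for the integrand extended by 0 to the strip around the diagonal. *)
Lemma integral_truncated_inner (F : V -> V -> R) e :
  (mu \x mu)%E.-integrable (off_diagonal e) (fun p => (F p.1 p.2)%:E) ->
  (\int[mu]_x truncated_inner F e x)%:E =
  (\int[mu \x mu]_(p in off_diagonal e) (F p.1 p.2)%:E)%E.
Proof.
move=> intF; have mO := measurable_off_diagonal e.
have /(integrable_mkcond _ mO) := intF; set f := (X in _.-integrable _ X) => intf.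
have fE x : (\int[mu]_z f (x, z) =
    \int[mu]_(z in [set z | (e <= enorm (z - x))%R]) (F x z)%:E)%E.
  rewrite [RHS]integral_mkcond; apply: eq_integral => z _.
  by rewrite /f !patchE; congr (if _ then _ else _); apply/idP/idP; rewrite !inE.
have int1 := integrable_fubini_F intf.
rewrite [RHS]integral_mkcond -/f -(integral12_prod_meas1 intf).
rewrite -[RHS]fineK; last by apply: integrable_fin_num.
congr (fine _)%:E.
have mF : measurable_fun setT (fubini_F mu f) by exact: measurable_int int1.
apply: ae_eq_integral => //.
  apply/measurable_EFinP.
  apply: (eq_measurable_fun (fine \o fubini_F mu f)).
    by move=> x _; rewrite /= /fubini_F fE.
  by apply: measurableT_comp => //; exact: measurable_fine.
(* The inner integral may be infinite for exceptional [x], where [fine] returns a default value;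
   these [x] form a null set. *)
have := integrable_ae measurableT int1; apply: filterS => x /(_ I) /= fin _.
by rewrite /truncated_inner /Rintegral -fE fineK.
Qed.

(* Integrate the pointwise bound over [e <= |x - z|], where [F] is integrable and
   symmetrization is legitimate, then let [e] tend to 0 using the last clause of
   [pv_integrable]. *)
Lemma pv_energy_le m (F : 'I_m -> V -> V -> R) (A B : V * V -> R) (b : R) :
  (forall i, pv_integrable (F i)) -> \sum_(i < m) pv_integral (F i) <= 0 ->
  measurable_fun setT A -> measurable_fun setT B ->
  (forall p, 0 <= A p) -> (forall p, 0 <= B p) -> (forall x, A (x, x) = 0) ->
  (forall p, A p <= \sum_(i < m) (F i p.1 p.2 + F i p.2 p.1) + B p) ->
  (\int[mu \x mu]_p (B p)%:E <= b%:E)%E ->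
  (\int[mu \x mu]_p (A p)%:E <= b%:E)%E.
Proof.
move=> Fpv pv0 mA mB A0 B0 Adiag AFB Bb.
(* The truncated region is symmetric, so both halves of the symmetrized integrand have the same
   integral; hence the factor 2. *)
have trunc (e : R) : 0 < e -> (\int[mu \x mu]_(p in off_diagonal e) (A p)%:E <=
    (2 * \sum_(i < m) \int[mu]_x truncated_inner (F i) e x + b)%:E)%E.
  move=> e0; have mO := measurable_off_diagonal e.
  pose f i := ((fun p => (F i p.1 p.2)%:E) \_ (off_diagonal e))%E.
  have intf i : (mu \x mu)%E.-integrable setT (f i).
    have [/(_ e e0) intF _ _ _] := Fpv i.
    exact: ((integrable_mkcond _ mO).1 intF).
  have intf' i := integrable_swap (intf i).
  have intB : (mu \x mu)%E.-integrable setT (EFin \o B).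
    apply/integrableP; split; first exact/measurable_EFinP.
    under eq_integral do rewrite /= ger0_norm//.
    by apply: le_lt_trans Bb _; rewrite ltry.
  have intS : (mu \x mu)%E.-integrable setT
      (fun p => \sum_(i < m) (f i p + f i (p.2, p.1)))%E.
    by apply: integrable_sum => // i _; exact: integrableD.
  rewrite integral_mkcond.
  apply: (@le_trans _ _ (\int[mu \x mu]_p
      (\sum_(i < m) (f i p + f i (p.2, p.1)) + (B p)%:E))%E).
    apply: ge0_le_integral => //.
    - by move=> p _; apply: erestrict_ge0 => q _; rewrite lee_fin.
    - apply/(measurable_restrictT _ _).1 => //.
      by apply: measurable_funTS; exact/measurable_EFinP.
    - apply: emeasurable_funD; last exact/measurable_EFinP.
      exact: measurable_int intS.
    - move=> p _; rewrite patchE; case: ifPn => [pO|pO].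
        rewrite (eq_bigr (fun i => (F i p.1 p.2 + F i p.2 p.1)%:E)) => [|i _].
          by rewrite sumEFin -EFinD lee_fin.
        rewrite /f !patchE pO ifT//.
        by move: pO; rewrite !inE /off_diagonal/= enorm_distC.
      rewrite big1 ?add0e ?lee_fin// => i _.
      rewrite /f !patchE (negbTE pO) ifF ?adde0//.
      by apply: contraNF pO; rewrite !inE /off_diagonal/= enorm_distC.
  rewrite integralD// EFinD; apply: leeD => //.
  have -> : (\int[mu \x mu]_p (\sum_(i < m) (f i p + f i (p.2, p.1))) =
      \sum_(i < m) \int[mu \x mu]_p (f i p + f i (p.2, p.1)))%E.
    by apply: integral_sum => // i; exact: integrableD.
  rewrite mulr_sumr -sumEFin; apply: lee_sum => i _.
  rewrite integralD// integral_swap// mulrDl mul1r EFinD.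
  rewrite integral_truncated_inner; last first.
    by have [intF _ _ _] := Fpv i; exact: intF.
  by rewrite [in leRHS]integral_mkcond.
have trunc0 (e : R) : 0 < e ->
    (\int[mu \x mu]_(p in off_diagonal e) (A p)%:E <= b%:E)%E.
  (* The radius [e] on the left stays fixed while a second radius [u <= e] is taken so small that
     twice the truncated sum is below [d]. *)
  move=> e0; apply/lee_addgt0Pr => d d0.
  have cvgI : (\sum_(i < m) \int[mu]_x truncated_inner (F i) u x)
      @[u --> 0^'+] --> \sum_(i < m) pv_integral (F i).
    apply: cvg_big => [|i _]; first exact: add_continuous.
    by have [] := Fpv i.
  near (0:R)^'+ => u.
  have u0 : 0 < u by near: u; exact: nbhs_right_gt.
  apply: (@le_trans _ _ (\int[mu \x mu]_(p in off_diagonal u) (A p)%:E)%E).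
    apply: ge0_subset_integral => //; try exact: measurable_off_diagonal.
    - by apply: measurable_funTS; exact/measurable_EFinP.
    - by move=> p _; rewrite lee_fin.
    - by move=> p; apply: le_trans; near: u; exact: nbhs_right_le.
  apply: le_trans (trunc u u0) _; rewrite -EFinD lee_fin.
  have : \sum_(i < m) \int[mu]_x truncated_inner (F i) u x < d / 2.
    by near: u; apply: (cvgr_lt _ cvgI); lra.
  by lra.
(* Monotone convergence: these regions increase to the complement of the diagonal, and [A] vanishes
   on the diagonal. *)
pose O k := off_diagonal (k.+1%:R^-1 : R).
have mO k : measurable (O k) by exact: measurable_off_diagonal.
have : (\int[mu \x mu]_(p in O k) (A p)%:E @[k --> \oo] -->
    \int[mu \x mu]_(p in \bigcup_k O k) (A p)%:E)%E.
  apply: ge0_nondecreasing_set_cvg_integral => //.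
  - apply/nondecreasing_seqP => k; apply/subsetPset => p; apply: le_trans.
    by rewrite lef_pV2 ?posrE// ler_nat.
  - by move=> k; apply: measurable_funTS; exact/measurable_EFinP.
  - by move=> k p _; rewrite lee_fin.
have -> : (\int[mu \x mu]_(p in \bigcup_k O k) (A p)%:E =
    \int[mu \x mu]_p (A p)%:E)%E.
  rewrite integral_mkcond; apply: eq_integral => p _.
  rewrite patchE; case: ifPn => // /negP pO.
  rewrite (_ : p = (p.1, p.1)) ?Adiag//; case: p pO => x z /= pO; congr pair.
  apply/eqP; rewrite -subr_eq0; apply/eqP/enorm_eq0/eqP.
  rewrite eq_le enorm_ge0 andbT leNgt; apply/negP => xz; apply: pO.
  rewrite inE; exists (Num.truncn (enorm (z - x))^-1) => //.
  by rewrite /O /off_diagonal /= -[leRHS]invrK lef_pV2 ?posrE ?invr_gt0// ltW// truncnS_gt.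
by move/cvge_to_le; apply; apply: nearW => k; exact: trunc0.
Unshelve. all: by end_near.
Qed.

End principal_values.

(** * Pointwise energy inequalities *)

Lemma energy_pointwise_eq (R : realFieldType) (a b w e : R) :
  1 / 2 * (w * (a - b) ^+ 2) * (e ^+ 2 + e ^+ 2) =
  a * (a - b) * w * e ^+ 2 + b * (b - a) * w * e ^+ 2.
Proof. by field. Qed.

(** With [u] and [v] as in the proof, the two test terms add up to [w] times
    [(a - b)^2 (ex^2 + ez^2) / 2 + u v / 2]. Young's inequality with parameter [delta] splits [u v]:
    [u^2] gives back energy, and [v^2] is controlled by the Lipschitz bound on the cutoff. *)
Lemma energy_pointwise_le (R : realFieldType) (a b w h k ex ez delta : R) :
  0 <= w -> 0 < delta -> (ex - ez) ^+ 2 <= k * h ^+ 2 ->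
  1 / 2 * (w * (a - b) ^+ 2) * (ex ^+ 2 + ez ^+ 2) <=
  a * (a - b) * w * ex ^+ 2 + b * (b - a) * w * ez ^+ 2
  + 1 / (2 * delta) * (w * (a - b) ^+ 2) * (ex ^+ 2 + ez ^+ 2)
  + delta / 4 * k * (w * (a + b) ^+ 2 * h ^+ 2).
Proof.
move=> w0 d0 exz.
pose u := (a - b) * (ex + ez); pose v := (a + b) * (ex - ez).
have young : - (1 / 2) * (u * v) <= 1 / (4 * delta) * u ^+ 2 + delta / 4 * v ^+ 2.
  rewrite -subr_ge0 (_ : _ - _ = (u + delta * v) ^+ 2 / (4 * delta)).
    by rewrite divr_ge0 ?sqr_ge0// mulr_ge0// ltW.
  by field; rewrite gt_eqF.
have uS : u ^+ 2 <= 2 * ((a - b) ^+ 2 * (ex ^+ 2 + ez ^+ 2)).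
  rewrite /u exprMn [leRHS]mulrCA ler_wpM2l ?sqr_ge0//.
  have := sqr_ge0 (ex - ez); rewrite !sqrrB sqrrD; lra.
have vk : v ^+ 2 <= k * ((a + b) ^+ 2 * h ^+ 2).
  by rewrite /v exprMn [leRHS]mulrCA ler_wpM2l ?sqr_ge0.
have i0 : 0 <= 1 / (4 * delta) by rewrite divr_ge0// mulr_ge0// ltW.
have d4 : 0 <= delta / 4 by rewrite divr_ge0// ltW.
have key := ler_wpM2l w0 (le_trans young (lerD (ler_wpM2l i0 uS) (ler_wpM2l d4 vk))).
rewrite -subr_ge0; move: key; rewrite -subr_ge0; congr (_ <= _).
by rewrite /u /v; field; rewrite gt_eqF.
Qed.

(** * Absorption along an exhaustion *)

Section vanishing.
Local Open Scope ereal_scope.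
Context d (T : measurableType d) (R : realType).
Variables (mu : {measure set T -> \bar R}) (D : T -> \bar R) (Q : nat -> set T).
Hypotheses (mD : measurable_fun setT D) (D0 : forall x, 0 <= D x).
Hypotheses (ndQ : nondecreasing_seq Q) (mQ : forall k, measurable (Q k))
  (QT : \bigcup_k Q k = setT).
Variables (N : nat) (K1 K2 : R).
Hypothesis bounded : forall k, (N <= k)%N -> \int[mu]_(x in Q k) D x <= K1%:E.
Hypothesis absorbed : forall k (delta : R), (N <= k)%N -> (0 < delta)%R ->
  \int[mu]_x D x < +oo ->
  \int[mu]_(x in Q k) D x <=
  (delta^-1)%:E * \int[mu]_(x in ~` Q k) D x + (delta * K2)%:E.

Lemma integral_eq0_of_absorption : \int[mu]_x D x = 0.
Proof.
have cvgQ : \int[mu]_(x in Q k) D x @[k --> \oo] --> \int[mu]_x D x.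
  rewrite -QT; apply: ge0_nondecreasing_set_cvg_integral => //.
  by move=> k; exact: measurable_funTS.
have Doo : \int[mu]_x D x < +oo.
  apply: (@le_lt_trans _ _ K1%:E); last exact: ltry.
  by apply: (cvge_to_le cvgQ); exists N => // k /= Nk; exact: bounded.
have D0T : 0 <= \int[mu]_x D x by exact: integral_ge0.
have finD : \int[mu]_x D x \is a fin_num by rewrite ge0_fin_numE.
have Qle k : \int[mu]_(x in Q k) D x <= \int[mu]_x D x.
  by apply: ge0_subset_integral.
have finQ k : \int[mu]_(x in Q k) D x \is a fin_num.
  by rewrite ge0_fin_numE ?integral_ge0//; exact: le_lt_trans (Qle k) Doo.
have QC k : \int[mu]_(x in ~` Q k) D x =
    \int[mu]_x D x - \int[mu]_(x in Q k) D x.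
  rewrite -(setUv (Q k)) ge0_integral_setU//; last 3 first.
  - exact: measurableC.
  - by rewrite setUv.
  - by apply/disj_setPCl.
  by rewrite addeAC subee// add0e.
set M := fine (\int[mu]_x D x).
have cvgQM : fine (\int[mu]_(x in Q k) D x) @[k --> \oo] --> M.
  by apply: fine_cvg; rewrite fineK.
have Mdelta (delta : R) : (0 < delta)%R -> (M <= delta * K2)%R.
  move=> d0.
  have cvgR : (delta^-1 * (M - fine (\int[mu]_(x in Q k) D x)) + delta * K2)%R
      @[k --> \oo] --> (delta^-1 * (M - M) + delta * K2)%R.
    apply: cvgD; last exact: cvg_cst.
    by apply: cvgM; [exact: cvg_cst|apply: cvgB => //; exact: cvg_cst].
  rewrite -[leRHS]add0r -(mulr0 (delta^-1)%R) -(subrr M).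
  apply: (ler_cvg_to cvgQM cvgR); exists N => // k /= Nk.
  have := absorbed Nk d0 Doo.
  by rewrite QC -(fineK finD) -(fineK (finQ k)) -EFinB -EFinM -EFinD lee_fin.
have M0 : (M <= 0)%R.
  apply/ler_addgt0Pr => e e0; rewrite add0r.
  (* The [+ 1] keeps the denominator positive when [K2 = 0]. *)
  apply: le_trans (Mdelta (e / (`|K2| + 1))%R _) _; first by rewrite divr_gt0// ltr_wpDl.
  rewrite mulrAC ler_pdivrMr ?ltr_wpDl// ler_wpM2l ?(ltW e0)//.
  by apply: le_trans (ler_norm _) _; rewrite lerDl.
by apply/eqP; rewrite eq_le D0T andbT -(fineK finD) lee_fin.
Qed.

End vanishing.

(** * The energy of sigma vanishes *)

Section energy.
Context {R : realType} {n m : nat}.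
Local Notation V := ('rV[R]_n).
Local Notation mu := (lebesgue_rV n : {sigma_finite_measure set V -> \bar R}).
Variables J sigma phi : 'I_m -> V -> R.
Hypotheses (mJ : forall i, measurable_fun setT (J i))
  (J0 : forall i y, 0 <= J i y) (Jeven : forall i y, J i (- y) = J i y)
  (msigma : forall i, measurable_fun setT (sigma i))
  (mphi : forall i, measurable_fun setT (phi i))
  (phi0 : forall i x z, 0 < phi i x * phi i z).
Implicit Types (p : V * V) (r : R).

Definition energy p : R := \sum_(i < m)
  phi i p.1 * phi i p.2 * J i (p.1 - p.2) * (sigma i p.1 - sigma i p.2) ^+ 2.

Definition growth p : R := \sum_(i < m)
  (sigma i p.1 + sigma i p.2) ^+ 2 * phi i p.1 * phi i p.2
  * enorm (p.1 - p.2) ^+ 2 * J i (p.1 - p.2).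

(** Written exactly as the integrand of the stability hypothesis, so that the hypothesis applies
    without rewriting. *)
Definition test_kernel (eta : V -> R) i x z : R :=
  sigma i x * (sigma i x - sigma i z) * phi i z * phi i x * J i (x - z)
  * eta x ^+ 2.

Definition Gamma r : set (V * V) :=
  Gamma1 r `|` Gamma2 r `|` Gamma3 r `|` Gamma4 r.

Let m1 : measurable_fun setT (@fst V V).
Proof. exact: measurable_fst. Qed.

Let m2 : measurable_fun setT (@snd V V).
Proof. exact: measurable_snd. Qed.

Let mB : measurable_fun setT (fun p : V * V => p.1 - p.2).
Proof. exact: measurable_rVB. Qed.

Lemma measurable_energy : measurable_fun setT energy.
Proof.
apply: measurable_sum => i; apply: measurable_funM.
  apply: measurable_funM; last exact: measurableT_comp (mJ i) mB.
  by apply: measurable_funM; [exact: measurableT_comp m1|exact: measurableT_comp m2].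
apply: measurable_funX; apply: measurable_funB.
  exact: measurableT_comp m1.
exact: measurableT_comp m2.
Qed.

Lemma measurable_growth_term i : measurable_fun setT (fun p : V * V =>
  (sigma i p.1 + sigma i p.2) ^+ 2 * phi i p.1 * phi i p.2
  * enorm (p.1 - p.2) ^+ 2 * J i (p.1 - p.2)).
Proof.
apply: measurable_funM; last exact: measurableT_comp (mJ i) mB.
apply: measurable_funM; last by apply: measurable_funX; exact: measurable_enorm.
apply: measurable_funM; last exact: measurableT_comp m2.
apply: measurable_funM; last exact: measurableT_comp m1.
apply: measurable_funX; apply: measurable_funD.
  exact: measurableT_comp m1.
exact: measurableT_comp m2.
Qed.

Lemma measurable_growth : measurable_fun setT growth.
Proof. by apply: measurable_sum => i; exact: measurable_growth_term. Qed.

Let weight_ge0 i x z : 0 <= phi i x * phi i z * J i (x - z).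
Proof. by rewrite mulr_ge0// ltW. Qed.

Lemma energy_ge0 p : 0 <= energy p.
Proof. by apply: sumr_ge0 => i _; rewrite mulr_ge0 ?sqr_ge0. Qed.

Let growth_term_ge0 i p :
  0 <= (sigma i p.1 + sigma i p.2) ^+ 2 * phi i p.1 * phi i p.2
       * enorm (p.1 - p.2) ^+ 2 * J i (p.1 - p.2).
Proof.
rewrite mulr_ge0// mulr_ge0 ?sqr_ge0// -mulrA mulr_ge0 ?sqr_ge0//.
exact: ltW.
Qed.

Lemma growth_ge0 p : 0 <= growth p.
Proof. by apply: sumr_ge0 => i _; exact: growth_term_ge0. Qed.

Let JC i x z : J i (x - z) = J i (z - x).
Proof. by rewrite -Jeven opprB. Qed.

Lemma growthC p : growth (p.2, p.1) = growth p.
Proof.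
apply: eq_bigr => i _ /=; rewrite JC enorm_distC (addrC (sigma i p.2)).
by congr (_ * _ * _); rewrite -!mulrA (mulrC (phi i p.2)).
Qed.

Lemma measurable_Gamma r : measurable (Gamma r).
Proof.
have mb s : measurable (eball s : set V) by exact: measurable_eball.
have mc s : measurable (~` eball s : set V) by exact: measurableC.
have ma s : measurable (eball (2 * s) `\` eball s : set V) by exact: measurableD.
by repeat apply: measurableU; exact: measurableX.
Qed.

(** Up to exchange, a pair avoiding every [Gamma_r^k] has both points in the ball of radius [r],
    where the cutoff is 1, or both off the ball of radius [2r], where it is 0. *)
Lemma cutoff_eq_off_Gamma r p : 0 < r -> ~ Gamma r p -> ~ Gamma r (p.2, p.1) ->
  cutoff r p.1 = cutoff r p.2.
Proof.
case: p => x z r0 /=; rewrite /Gamma /Gamma1 /Gamma2 /Gamma3 /Gamma4 /eball /=.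
have [xr|xr] := ltP (enorm x) r; have [zr|zr] := ltP (enorm z) r.
- by rewrite !cutoff_eq1// ltW.
- have [z2r|z2r] := ltP (enorm z) (2 * r); move=> G _; exfalso; apply: G.
    by left; left; left; split=> //; split => //; rewrite ltNge zr.
  by right; split => //; rewrite ltNge z2r.
- have [x2r|x2r] := ltP (enorm x) (2 * r); move=> _ G; exfalso; apply: G.
    by left; left; left; split=> //; split => //; rewrite ltNge xr.
  by right; split => //; rewrite ltNge x2r.
- have [x2r|x2r] := ltP (enorm x) (2 * r); have [z2r|z2r] := ltP (enorm z) (2 * r).
  + move=> G _; exfalso; apply: G.
    by left; left; right; split; split => //; rewrite ltNge ?xr ?zr.
  + move=> G _; exfalso; apply: G.
    by left; right; do ![split] => // /= h; lra.
  + move=> _ G; exfalso; apply: G.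
    by left; right; do ![split] => // /= h; lra.
  + by rewrite !cutoff_eq0.
Qed.

(** Each [Gamma_r^k] has a factor outside the ball of radius [r]. This places the energy error off
    [eball r] x [eball r], where finite energy makes it tend to 0. *)
Lemma Gamma_disjoint_ball r : 0 < r -> Gamma r `<=` ~` (eball r `*` eball r).
Proof.
move=> r0 [x z] G [xr zr]; move: G xr zr.
rewrite /Gamma /Gamma1 /Gamma2 /Gamma3 /Gamma4 /eball /=.
move=> [[[[_ [_ h]]|[[_ h] _]]|[[_ h] _]]|[_ h]] xr zr //.
by apply: h; apply: lt_trans zr _; lra.
Qed.

(* The sets Gamma_r^k only list one of [(x, z)] and [(z, x)]. *)
Let growthG r p : R := (growth \_ (Gamma r)) p + (growth \_ (Gamma r)) (p.2, p.1).

Let growthG_ge0 r p : 0 <= growthG r p.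
Proof.
by rewrite addr_ge0// patchE; case: ifP => // _; exact: growth_ge0.
Qed.

(** The square of the constant in [cutoff_lipschitz], without its factor [1 / r]. *)
Let sqr_lipschitz_const : R := (10 * n%:R + 1) ^+ 2.

Lemma energy_test_le (delta r : R) p : 0 < r -> 0 < delta ->
  1 / 2 * energy p * (cutoff r p.1 ^+ 2 + cutoff r p.2 ^+ 2) <=
  \sum_(i < m) (test_kernel (cutoff r) i p.1 p.2 + test_kernel (cutoff r) i p.2 p.1)
  + 1 / (2 * delta) * (energy \_ (~` (eball r `*` eball r))) p
    * (cutoff r p.1 ^+ 2 + cutoff r p.2 ^+ 2)
  + delta / 4 * (sqr_lipschitz_const / r ^+ 2) * growthG r p.
Proof.
move=> r0 d0; set ex := cutoff r p.1; set ez := cutoff r p.2.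
have EQ0 : 0 <= (energy \_ (~` (eball r `*` eball r))) p.
  by rewrite patchE; case: ifP => // _; exact: energy_ge0.
have c0 : 0 <= delta / 4 * (sqr_lipschitz_const / r ^+ 2).
  by rewrite mulr_ge0 ?divr_ge0 ?sqr_ge0 ?ltW.
have d20 : 0 <= 1 / (2 * delta) by rewrite divr_ge0// mulr_ge0// ltW.
have [G|/not_orP[G G']] := pselect (Gamma r p \/ Gamma r (p.2, p.1)).
- have -> : (energy \_ (~` (eball r `*` eball r))) p = energy p.
    rewrite patchE ifT// inE => -[p1 p2]; case: G => /(Gamma_disjoint_ball r0); exact.
  apply: (@le_trans _ _ (\sum_(i < m)
    (test_kernel (cutoff r) i p.1 p.2 + test_kernel (cutoff r) i p.2 p.1)
    + 1 / (2 * delta) * energy p * (ex ^+ 2 + ez ^+ 2)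
    + delta / 4 * (sqr_lipschitz_const / r ^+ 2) * growth p)); last first.
    rewrite lerD2l ler_wpM2l// /growthG !patchE.
    case: G => [Gp|Gp]; rewrite (mem_set Gp) ?growthC ?lerDl ?lerDr;
      by case: ifP => // _; exact: growth_ge0.
  rewrite /energy /growth !mulr_sumr !mulr_suml -!big_split/=; apply: ler_sum => i _.
  have := @energy_pointwise_le R (sigma i p.1) (sigma i p.2) _ (enorm (p.1 - p.2))
    (sqr_lipschitz_const / r ^+ 2) ex ez delta (weight_ge0 i p.1 p.2) d0.
  have lip : (ex - ez) ^+ 2 <= sqr_lipschitz_const / r ^+ 2 * enorm (p.1 - p.2) ^+ 2.
    rewrite -real_normK ?num_real// /sqr_lipschitz_const -expr_div_n -exprMn.
    rewrite ler_pXn2r// ?nnegrE//; first exact: cutoff_lipschitz.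
    by rewrite mulr_ge0 ?enorm_ge0// divr_ge0 ?(ltW r0).
  move=> /(_ lip); rewrite /test_kernel (JC i p.2 p.1) -/ex -/ez.
  set j := J i _; set h := enorm _; move=> le.
  rewrite -subr_ge0; move: le; rewrite -subr_ge0; congr (_ <= _).
  by field; rewrite !gt_eqF.
(* Equal cutoff values turn the inequality into an identity plus nonnegative error terms. *)
- have ee : ex = ez by exact: cutoff_eq_off_Gamma.
  rewrite -addrA -[leLHS]addr0; apply: lerD; last first.
    apply: addr_ge0; apply: mulr_ge0 => //; first exact: mulr_ge0.
    by rewrite addr_ge0 ?sqr_ge0.
  rewrite /energy mulr_sumr mulr_suml; apply: ler_sum => i _.
  rewrite /test_kernel (JC i p.2 p.1) -/ex -/ez ee.
  by rewrite energy_pointwise_eq le_eqVlt; apply/orP; left; apply/eqP; ring.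
Qed.

Let measurable_growth_Gamma r : measurable_fun setT (growth \_ (Gamma r)).
Proof.
apply: (measurable_restrictT _ (measurable_Gamma r)).1.
by apply: measurable_funTS; exact: measurable_growth.
Qed.

Let measurable_growthG r : measurable_fun setT (growthG r).
Proof.
apply: measurable_funD => //.
apply: (measurableT_comp (measurable_growth_Gamma r)).
exact: measurable_fun_pair.
Qed.

(** The factor 2 counts [Gamma r] and its mirror image, which contribute equally because [growth] is
    symmetric. *)
Let integral_growthG (kappa c r : R) : 0 <= kappa ->
  (\sum_(i < m) \int[mu \x mu]_(p in Gamma r)
     ((sigma i p.1 + sigma i p.2) ^+ 2 * phi i p.1 * phi i p.2
      * enorm (p.1 - p.2) ^+ 2 * J i (p.1 - p.2))%:E <= c%:E)%E ->
  (\int[mu \x mu]_p (kappa * growthG r p)%:E <= (kappa * (2 * c))%:E)%E.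
Proof.
move=> k0; rewrite -ge0_integral_sum; last 3 first.
- exact: measurable_Gamma.
- by move=> i; apply: measurable_funTS; apply/measurable_EFinP;
    exact: measurable_growth_term.
- by move=> i p _; rewrite lee_fin.
under eq_integral do rewrite sumEFin.
rewrite integral_mkcond => growth_le.
have mg : measurable_fun setT (EFin \o (growth \_ (Gamma r))).
  exact/measurable_EFinP.
have g0 p : (0 <= (EFin \o (growth \_ (Gamma r))) p)%E.
  by rewrite lee_fin patchE; case: ifP => // _; exact: growth_ge0.
under eq_integral do rewrite EFinM.
rewrite ge0_integralZl_EFin//; last 2 first.
- by move=> p _; rewrite lee_fin.
- exact/measurable_EFinP.
rewrite EFinM lee_wpmul2l ?lee_fin//.
under eq_integral do rewrite EFinD.
rewrite ge0_integralD//; last 3 first.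
- by move=> p _; exact: g0.
- by move=> p _; exact: (g0 (p.2, p.1)).
- by apply: (measurableT_comp mg); exact: measurable_fun_pair.
have := ge0_integral_swap mu mg g0; rewrite /= => ->.
rewrite mulrDl mul1r EFinD.
have -> : (\int[mu \x mu]_p ((growth \_ (Gamma r)) p)%:E =
    \int[mu \x mu]_p (((EFin \o growth) \_ (Gamma r)) p))%E.
  by rewrite restrict_EFin.
exact: leeD.
Qed.

Variables (C : R) (N : nat).
Hypothesis stable : forall eta, Cc1 eta ->
  (forall i, pv_integrable (test_kernel eta i)) /\
  \sum_(i < m) pv_integral (test_kernel eta i) <= 0.
Hypothesis growth_bound : forall k, (N <= k)%N -> (0 < k)%N /\
  (\sum_(i < m) \int[mu \x mu]_(p in Gamma k%:R)
     ((sigma i p.1 + sigma i p.2) ^+ 2 * phi i p.1 * phi i p.2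
      * enorm (p.1 - p.2) ^+ 2 * J i (p.1 - p.2))%:E
     <= (C * k%:R ^+ 2)%:E)%E.

Let Q k : set (V * V) := eball k%:R `*` eball k%:R.

Let mQ k : measurable (Q k).
Proof. by apply: measurableX; exact: measurable_eball. Qed.

Let energyQ_ge0 (A : set (V * V)) p : 0 <= (energy \_ A) p.
Proof. by rewrite patchE; case: ifP => // _; exact: energy_ge0. Qed.

Let measurable_energyQ (A : set (V * V)) : measurable A ->
  measurable_fun setT (energy \_ A).
Proof.
move=> mA; apply: (measurable_restrictT _ mA).1.
by apply: measurable_funTS; exact: measurable_energy.
Qed.

Let energy_diag (A : set (V * V)) x : (energy \_ A) (x, x) = 0.
Proof.
rewrite patchE; case: ifP => // _; rewrite /energy big1// => i _ /=.
by rewrite (subrr (sigma i x)) expr0n mulr0.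
Qed.

Let energy_onQ k p : (0 < k)%N -> (energy \_ (Q k)) p <=
  1 / 2 * energy p * (cutoff k%:R p.1 ^+ 2 + cutoff k%:R p.2 ^+ 2).
Proof.
move=> k0; rewrite patchE; case: ifPn => [|_].
  rewrite inE => -[/= p1 p2]; have kR0 : 0 < k%:R :> R by rewrite ltr0n.
  rewrite (cutoff_eq1 kR0 (ltW p1)) (cutoff_eq1 kR0 (ltW p2)).
  by rewrite expr1n; have := energy_ge0 p; lra.
by rewrite !mulr_ge0 ?energy_ge0// addr_ge0 ?sqr_ge0.
Qed.

Lemma integral_energy_eq0 : (\int[mu \x mu]_p (energy p)%:E = 0)%E.
Proof.
(* Write [L] for [sqr_lipschitz_const]. The error integral is [delta / 4 * L / k^2 * 2 C k^2 = delta
   * L * C / 2], in which [k] cancels: this gives the last constant, and twice its value at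
   [delta = 2] gives the first. *)
apply: (@integral_eq0_of_absorption _ _ _ _ _ Q _ _ _ _ _ N
  (2 * (sqr_lipschitz_const * C)) (sqr_lipschitz_const * C / 2)).
- by apply/measurable_EFinP; exact: measurable_energy.
- by move=> p; rewrite lee_fin energy_ge0.
- apply/nondecreasing_seqP => k; apply/subsetPset => -[x z] [/= xk zk].
  by split; rewrite /eball/=; [apply: lt_le_trans xk _|apply: lt_le_trans zk _];
    rewrite ler_nat.
- exact: mQ.
- rewrite -subTset => -[x z] _.
  exists (Num.truncn (enorm x + enorm z)).+1 => //.
  have := truncnS_gt (enorm x + enorm z).
  by have := (enorm_ge0 x, enorm_ge0 z) => -[] *; split; rewrite /eball/=; lra.
(* Absorb half of the energy on the left, with [delta = 2]. *)
- move=> k Nk; have [k0 gk] := growth_bound Nk.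
  have kR0 : 0 < k%:R :> R by rewrite ltr0n.
  have [pvi pvs] := stable (cutoff_Cc1 kR0).
  have kap0 : 0 <= 2 / 4 * (sqr_lipschitz_const / k%:R ^+ 2).
    by rewrite mulr_ge0// divr_ge0 ?sqr_ge0.
  have bB := integral_growthG kap0 gk.
  have half : (\int[mu \x mu]_p (1 / 2 * (energy \_ (Q k)) p)%:E <=
      (2 / 4 * (sqr_lipschitz_const / k%:R ^+ 2) * (2 * (C * k%:R ^+ 2)))%:E)%E.
    apply: (pv_energy_le pvi pvs _ _ _ _ _ _ bB).
    + by apply: measurable_funM => //; exact: measurable_energyQ.
    + by apply: measurable_funM.
    + by move=> p; rewrite mulr_ge0.
    + by move=> p; rewrite mulr_ge0.
    + by move=> x; rewrite energy_diag mulr0.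
    + move=> p; have := energy_test_le p kR0 (ltr0Sn R 1).
      have := energy_onQ p k0.
      have : (energy \_ (~` Q k)) p <= energy p.
        by rewrite patchE; case: ifP => // _; exact: energy_ge0.
      have : 0 <= cutoff k%:R p.1 ^+ 2 + cutoff k%:R p.2 ^+ 2.
        by rewrite addr_ge0 ?sqr_ge0.
      rewrite /Q; set S := cutoff _ _ ^+ 2 + _; set E := (energy \_ _) p.
      set t := \sum_(i < m) _; nra.
  rewrite integral_mkcond restrict_EFin.
  have scale : (\int[mu \x mu]_p (1 / 2 * (energy \_ (Q k)) p)%:E =
      (1 / 2)%:E * \int[mu \x mu]_p ((energy \_ (Q k)) p)%:E)%E.
    rewrite -ge0_integralZl_EFin//.
    + by move=> p _; rewrite lee_fin.
    + by apply/measurable_EFinP; exact: measurable_energyQ.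
  move: half; rewrite scale mul1r lee_pdivrMl// -EFinM => /le_trans; apply.
  by rewrite lee_fin le_eqVlt; apply/orP; left; apply/eqP; field; rewrite gt_eqF.
(* Here [delta] stays free: the cutoff squares add up to at most 2, so the energy error is at most
   [delta^-1] times the energy off [Q k]. *)
- move=> k delta Nk d0 energy_oo; have [k0 gk] := growth_bound Nk.
  have kR0 : 0 < k%:R :> R by rewrite ltr0n.
  have [pvi pvs] := stable (cutoff_Cc1 kR0).
  have kap0 : 0 <= delta / 4 * (sqr_lipschitz_const / k%:R ^+ 2).
    by rewrite mulr_ge0 ?divr_ge0 ?sqr_ge0 ?ltW.
  have bB := integral_growthG kap0 gk.
  have mQC : measurable (~` Q k) by exact: measurableC.
  have finQC : (\int[mu \x mu]_(p in ~` Q k) (energy p)%:E)%E \is a fin_num.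
    rewrite ge0_fin_numE; last by apply: integral_ge0 => p _; rewrite lee_fin energy_ge0.
    apply: le_lt_trans energy_oo; apply: ge0_subset_integral => //.
      by apply/measurable_EFinP; exact: measurable_energy.
    by move=> p _; rewrite lee_fin energy_ge0.
  rewrite integral_mkcond restrict_EFin.
  rewrite -(fineK finQC) -EFinM -EFinD.
  apply: (pv_energy_le (B := fun p => delta^-1 * (energy \_ (~` Q k)) p +
      delta / 4 * (sqr_lipschitz_const / k%:R ^+ 2) * growthG k%:R p) pvi pvs) => //.
  + exact: measurable_energyQ.
  + apply: measurable_funD; apply: measurable_funM => //.
    exact: measurable_energyQ.
  + by move=> p; rewrite addr_ge0// mulr_ge0// invr_ge0 ltW.
  + move=> p; have := energy_test_le p kR0 d0.
    have := energy_onQ p k0.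
    rewrite -/(Q k); set S := cutoff _ _ ^+ 2 + _; set E := (energy \_ (~` _)) p.
    set t := \sum_(i < m) _.
    have S2 : S <= 2.
      have := (cutoff_ge0 k%:R p.1, cutoff_le1 k%:R p.1).
      have := (cutoff_ge0 k%:R p.2, cutoff_le1 k%:R p.2).
      by move=> -[? ?] [? ?]; rewrite /S; nra.
    have iE : 0 <= delta^-1 * E 
      by apply: mulr_ge0; [rewrite invr_ge0 ltW|exact: energyQ_ge0].
    have -> : 1 / (2 * delta) * E * S = delta^-1 * E * S / 2.
      by field; rewrite gt_eqF.
    by nra.
  + have iQC : 0 <= delta^-1 by rewrite invr_ge0 ltW.
    under eq_integral do rewrite EFinD.
    rewrite ge0_integralD//; last 4 first.
    * by move=> p _; rewrite lee_fin mulr_ge0.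
    * apply/measurable_EFinP; apply: measurable_funM => //.
      exact: measurable_energyQ.
    * by move=> p _; rewrite lee_fin mulr_ge0.
    * by apply/measurable_EFinP; exact: measurable_funM.
    rewrite EFinD; apply: leeD.
      under eq_integral do rewrite EFinM.
      rewrite ge0_integralZl_EFin//; last 2 first.
      * by move=> p _; rewrite lee_fin.
      * by apply/measurable_EFinP; exact: measurable_energyQ.
      by rewrite EFinM fineK// [in leRHS]integral_mkcond restrict_EFin.
    apply: le_trans bB _; rewrite lee_fin le_eqVlt; apply/orP; left; apply/eqP.
    by field; rewrite gt_eqF.
Qed.

End energy.

(** * From zero energy to constancy *)

Unset Implicit Arguments.
Set Strict Implicit.

Theorem proposition4p1 (R : realType) (n m : nat)
    (J sigma phi : 'I_m -> 'rV[R]_n -> R) :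
  (0 < n)%N -> (0 < m)%N ->
  (forall i, measurable_fun setT (J i)) ->
  (forall i y, 0 <= J i y) ->
  (forall i y, J i (- y) = J i y) ->
  (forall i, ~ {ae lebesgue_rV n, forall y, J i y = 0}) ->
  (forall i, measurable_fun setT (sigma i)) ->
  (forall i, measurable_fun setT (phi i)) ->
  (forall i x z, 0 < phi i x * phi i z) ->
  (forall eta : 'rV[R]_n -> R, Cc1 eta ->
     let F i x z := sigma i x * (sigma i x - sigma i z) * phi i z * phi i x
                    * J i (x - z) * eta x ^+ 2 in
     (forall i, pv_integrable (F i)) /\
     \sum_(i < m) pv_integral (F i) <= 0) ->
  (exists C : R, \forall r \near (+oo : set_system R),
     (\sum_(i < m)
        \int[lebesgue_rV n \x lebesgue_rV n]_(p in
             Gamma1 r `|` Gamma2 r `|` Gamma3 r `|` Gamma4 r)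
          ((sigma i p.1 + sigma i p.2) ^+ 2 * phi i p.1 * phi i p.2
           * enorm (p.1 - p.2) ^+ 2 * J i (p.1 - p.2))%:E
      <= (C * r ^+ 2)%:E)%E) ->
  forall i,
    (exists c : R, {ae lebesgue_rV n, forall x, sigma i x = c}) /\
    (continuous (sigma i) -> exists c : R, forall x, sigma i x = c).
Proof.
move=> _ _ mJ J0 Jeven Jneq0 msigma mphi phi0 stable [C growth] i.
have [N growthN] : exists N, forall k, (N <= k)%N -> (0 < k)%N /\
    (\sum_(i < m) \int[lebesgue_rV n \x lebesgue_rV n]_(p in Gamma k%:R)
       ((sigma i p.1 + sigma i p.2) ^+ 2 * phi i p.1 * phi i p.2
        * enorm (p.1 - p.2) ^+ 2 * J i (p.1 - p.2))%:E
     <= (C * k%:R ^+ 2)%:E)%E.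
  (* The successor makes the threshold exceed [M] and be positive. *)
  case: growth => M [_ growthM]; exists (Num.truncn M).+1 => k Mk.
  split; first exact: leq_trans Mk.
  by apply: growthM; apply: lt_le_trans (truncnS_gt M) _; rewrite ler_nat.
have energy0 := integral_energy_eq0 mJ J0 Jeven msigma mphi phi0 stable growthN.
have menergy := measurable_energy mJ msigma mphi.
have sigmaJ : (lebesgue_rV n \x lebesgue_rV n)%E
    [set p | J i (p.1 - p.2) <> 0 /\ sigma i p.1 <> sigma i p.2] = 0%E.
  have mE : measurable_fun setT (EFin \o energy J sigma phi).
    by apply/measurable_EFinP.
  have energy_ae0 := (ae_eq_integral_abs
    (lebesgue_rV n \x lebesgue_rV n)%E measurableT mE).1.
  apply: measure_negligible.
    apply: (measurableI [set p | J i (p.1 - p.2) <> 0]); apply: measurable_neq_set => //.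
    - by apply: measurableT_comp => //; exact: measurable_rVB.
    - by apply: measurableT_comp => //; exact: measurable_fst.
    - by apply: measurableT_comp => //; exact: measurable_snd.
  apply: negligibleS (energy_ae0 _); last first.
    rewrite -[RHS]energy0; apply: eq_integral => p _.
    by rewrite gee0_abs// lee_fin energy_ge0.
  (* All summands of the energy are nonnegative, and the [i]-th is positive at such a [p], so the
     energy cannot vanish there. *)
  move=> p /= [Jp sp] /(_ I) [] /eqP; apply/negP; rewrite gt_eqF//.
  rewrite /energy (bigD1 i)//= ltr_pwDl//.
    rewrite mulr_gt0 ?exprn_even_gt0 ?subr_eq0//=; last exact/eqP.
    by rewrite mulr_gt0// lt_neqAle J0 andbT eq_sym; apply/eqP.
  by apply: sumr_ge0 => j _; rewrite mulr_ge0 ?sqr_ge0// mulr_ge0// ltW.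
have [c sigmac] := ae_constant_of_periods (msigma i) (mJ i) (Jneq0 i) sigmaJ.
split; first by exists c.
by move=> csigma; exists c; exact: continuous_ae_constant.
Qed.
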